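(* Let $M$ be a $C^2$ submanifold of $\mathbb{R}^d$ of dimension $m$ with $1\le m<d$. Then the map $$\varphi:\nu^*(M)\to\nu(M),\qquad (\xi,v)\mapsto(\xi,\overline{\vartheta}(\xi,v)\,v)$$ is a homeomorphism with inverse $$\varphi^{-1}:\nu(M)\to\nu^*(M),\qquad(\xi,w)\mapsto(\xi,\underline{\vartheta}(\xi,w)\,w).$$ Moreover, the homeomorphism $\sigma:=\varphi\circ(F^* )^{-1}:\mathcal{E}(M)\to\nu(M)$ makes $\mathcal{E}(M)$ a vector bundle with bundle map $p:\mathcal{E}(M)\to M$. Through transport from $\nu(M)$, the vector operations on $p^{-1}(\{\xi\})$ for $\xi\in M$ are given by $+_\xi=\sigma^{-1}\circ+\circ(\sigma\times\sigma)$ and $\cdot_\xi=\sigma^{-1}\circ\cdot\circ(\mathrm{id}_{\mathbb{R}}\times\sigma)$, where $(+,\cdot)$ are the vector operations on the normal space $(T_\xi(M))^\perp$ (identified with the fiber $\{\xi\}\times(T_\xi(M))^\perp$ of $\nu(M)$).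
   Context: Submanifolds are nonempty. A set $M\subseteq\mathbb{R}^d$ is an $m$-dimensional $C^k$ submanifold of $\mathbb{R}^d$ if for every $\xi\in M$ there are open sets $U,V\subseteq\mathbb{R}^d$ with $\xi\in U$ and a $C^k$ diffeomorphism $\Psi:V\to U$ such that for all $y\in V$: $\Psi(y)\in M\iff y_{m+1}=\dots=y_d=0$. $T_\xi(M)$ denotes the tangent space (a linear subspace of $\mathbb{R}^d$). $d(x,M)=\inf_{\xi\in M}\|x-\xi\|$ (Euclidean norm). $\operatorname{unpp}(M)$ is the set of $x\in\mathbb{R}^d$ for which there is exactly one $\xi\in M$ with $\|x-\xi\|=d(x,M)$; this $\xi$ is denoted $p(x)$. $\mathcal{E}(M)$ is the interior of $\operatorname{unpp}(M)$; here $p$ is regarded as a map on $\mathcal{E}(M)$. $\nu(M):=\{(\xi,v)\in\mathbb{R}^d\times\mathbb{R}^d:\xi\in M,\ v\perp T_\xi(M)\}$ is the normal bundle, $\nu_1(M):=\{(\xi,v)\in\nu(M):\|v\|=1\}$, and $\nu^*(M):=\{(\xi,v)\in\nu(M):[\xi,\xi+v]\subseteq\mathcal{E}(M)\}$, all with subspace topologies ($[a,b]$ is the closed, $]a,b[$ the open line segment). $F^*:\nu^*(M)\to\mathcal{E}(M)$ is the map $F^*(\xi,v)=\xi+v$ (it is a homeomorphism). The frontier function $\vartheta:\nu_1(M)\to(0,\infty]$ is $\vartheta(\xi,v):=\sup\{r>0:\ ]\xi,\xi+rv[\ \subseteq\mathcal{E}(M)\}$. The functions $\overline{\vartheta}:\nu^*(M)\to[1,\infty)$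 and $\underline{\vartheta}:\nu(M)\to(0,1]$ are $$\overline{\vartheta}(\xi,v)=\frac{\vartheta(\xi,v/\|v\|)}{\vartheta(\xi,v/\|v\|)-\|v\|}\ \text{ if }v\ne0\text{ and }\vartheta(\xi,v/\|v\|)<\infty,\qquad \overline{\vartheta}(\xi,v)=1\text{ otherwise},$$ $$\underline{\vartheta}(\xi,w)=\frac{\vartheta(\xi,w/\|w\|)}{\vartheta(\xi,w/\|w\|)+\|w\|}\ \text{ if }w\ne0\text{ and }\vartheta(\xi,w/\|w\|)<\infty,\qquad \underline{\vartheta}(\xi,w)=1\text{ otherwise}.$$ *)

(* Defs.v *)
(* MathComp-Analysis. *)
From HB Require Import structures.
From mathcomp Require Import all_boot all_order all_algebra.
From mathcomp Require Import all_classical all_reals all_analysis.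

Set Implicit Arguments.
Unset Strict Implicit.
Unset Printing Implicit Defensive.

Import Order.TTheory GRing.Theory Num.Theory.
Import numFieldNormedType.Exports.

Local Open Scope classical_set_scope.
Local Open Scope ring_scope.

(* The library norm `|_| on 'rV[R]_d is the sup norm. It induces the usual
   topology and the usual notion of differentiability of R^d, so it is used for
   those; the Euclidean norm, needed for distances and angles, is [enorm]. *)
Definition dot (R : realType) (d : nat) (u v : 'rV[R]_d) : R :=
  \sum_(i < d) u ord0 i * v ord0 i.

Definition enorm (R : realType) (d : nat) (v : 'rV[R]_d) : R :=
  Num.sqrt (dot v v).

Definition closed_segment (R : realType) (d : nat) (a b : 'rV[R]_d)
    : set 'rV[R]_d :=
  [set a + t *: (b - a) | t in `[0, 1]%classic].

Definition open_segment (R : realType) (d : nat) (a b : 'rV[R]_d)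
    : set 'rV[R]_d :=
  [set a + t *: (b - a) | t in `]0, 1[%classic].

(* f is C^k on the open set D. In finite dimension, continuity of x |-> 'd f x
   in operator norm is continuity of x |-> 'd f x v for every v. *)
Fixpoint Ck (R : realType) (V W : normedModType R) (k : nat) (f : V -> W)
    (D : set V) : Prop :=
  match k with
  | 0%N => forall x, D x -> {for x, continuous f}
  | k'.+1 => (forall x, D x -> differentiable f x) /\
             forall v : V, Ck k' (fun x => 'd f x v) D
  end.

Record Ck_diffeomorphism (R : realType) (d k : nat) (V U : set 'rV[R]_d)
    (Psi Phi : 'rV[R]_d -> 'rV[R]_d) : Prop := {
  diffeo_fun : set_fun V U Psi;
  diffeo_inv_fun : set_fun U V Phi;
  diffeo_K : {in V, cancel Psi Phi};
  diffeo_invK : {in U, cancel Phi Psi};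
  diffeo_Ck : Ck k Psi V;
  diffeo_inv_Ck : Ck k Phi U }.

(* Coordinates are numbered from 0, so the last d - m of them are the
   i : 'I_d with m <= i. *)
Definition is_submanifold (R : realType) (d k m : nat) (M : set 'rV[R]_d)
    : Prop :=
  M !=set0 /\
  forall xi, M xi -> exists (U V : set 'rV[R]_d) (Psi Phi : 'rV[R]_d -> 'rV[R]_d),
    [/\ open U, open V, U xi, Ck_diffeomorphism k V U Psi Phi &
        forall y, V y ->
          (M (Psi y) <-> forall i : 'I_d, (m <= i)%N -> y ord0 i = 0)].

(* Velocities at xi of the C^1 curves in M through xi. *)
Definition tangent_space (R : realType) (d : nat) (M : set 'rV[R]_d)
    (xi : 'rV[R]_d) : set 'rV[R]_d :=
  [set v | exists (e : R) (gamma : R -> 'rV[R]_d),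
    [/\ 0 < e, Ck 1 gamma `]- e, e[%classic,
        forall t : R, `]- e, e[%classic t -> M (gamma t),
        gamma 0 = xi & derive1 gamma 0 = v]].

Definition normal_space (R : realType) (d : nat) (M : set 'rV[R]_d)
    (xi : 'rV[R]_d) : set 'rV[R]_d :=
  [set v | forall u, tangent_space M xi u -> dot v u = 0].

Definition dist_to (R : realType) (d : nat) (x : 'rV[R]_d) (M : set 'rV[R]_d)
    : R :=
  inf [set enorm (x - xi) | xi in M].

Definition nearest (R : realType) (d : nat) (M : set 'rV[R]_d) (x : 'rV[R]_d)
    : set 'rV[R]_d :=
  [set xi | M xi /\ enorm (x - xi) = dist_to x M].

Definition unpp (R : realType) (d : nat) (M : set 'rV[R]_d) : set 'rV[R]_d :=
  [set x | exists! xi, nearest M x xi].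

(* Meaningful for x in unpp M. *)
Definition metric_proj (R : realType) (d : nat) (M : set 'rV[R]_d)
    (x : 'rV[R]_d) : 'rV[R]_d :=
  xget 0 (nearest M x).

Definition calE (R : realType) (d : nat) (M : set 'rV[R]_d) : set 'rV[R]_d :=
  (unpp M)°.

Definition nu (R : realType) (d : nat) (M : set 'rV[R]_d)
    : set ('rV[R]_d * 'rV[R]_d) :=
  [set z | M z.1 /\ normal_space M z.1 z.2].

Definition nu_star (R : realType) (d : nat) (M : set 'rV[R]_d)
    : set ('rV[R]_d * 'rV[R]_d) :=
  [set z | nu M z /\ closed_segment z.1 (z.1 + z.2) `<=` calE M].

Definition Fstar (R : realType) (d : nat) (z : 'rV[R]_d * 'rV[R]_d)
    : 'rV[R]_d :=
  z.1 + z.2.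

(* Meaningful for (xi, v) in nu M with enorm v = 1. *)
Definition frontier_fun (R : realType) (d : nat) (M : set 'rV[R]_d)
    (xi v : 'rV[R]_d) : \bar R :=
  ereal_sup [set r%:E | r in
    [set r : R | 0 < r /\ open_segment xi (xi + r *: v) `<=` calE M]].

Definition upper_theta (R : realType) (d : nat) (M : set 'rV[R]_d)
    (xi v : 'rV[R]_d) : R :=
  let th := frontier_fun M xi ((enorm v)^-1 *: v) in
  if (v != 0) && (th < +oo)%E then fine th / (fine th - enorm v) else 1.

Definition lower_theta (R : realType) (d : nat) (M : set 'rV[R]_d)
    (xi w : 'rV[R]_d) : R :=
  let th := frontier_fun M xi ((enorm w)^-1 *: w) in
  if (w != 0) && (th < +oo)%E then fine th / (fine th + enorm w) else 1.

Definition phi (R : realType) (d : nat) (M : set 'rV[R]_d)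
    (z : 'rV[R]_d * 'rV[R]_d) : 'rV[R]_d * 'rV[R]_d :=
  (z.1, upper_theta M z.1 z.2 *: z.2).

Definition phi_inv (R : realType) (d : nat) (M : set 'rV[R]_d)
    (z : 'rV[R]_d * 'rV[R]_d) : 'rV[R]_d * 'rV[R]_d :=
  (z.1, lower_theta M z.1 z.2 *: z.2).

(* [pinv A f] is the inverse of the restriction of f to A. *)
Definition sigma (R : realType) (d : nat) (M : set 'rV[R]_d)
    : 'rV[R]_d -> 'rV[R]_d * 'rV[R]_d :=
  phi M \o pinv (nu_star M) (@Fstar R d).

Definition sigma_inv (R : realType) (d : nat) (M : set 'rV[R]_d)
    : 'rV[R]_d * 'rV[R]_d -> 'rV[R]_d :=
  @Fstar R d \o phi_inv M.

(* f and g are mutually inverse homeomorphisms between A and B, with their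
   subspace topologies. *)
Record homeomorphism_between (X Y : topologicalType) (A : set X) (B : set Y)
    (f : X -> Y) (g : Y -> X) : Prop := {
  homeo_fun : set_fun A B f;
  homeo_inv_fun : set_fun B A g;
  homeo_K : {in A, cancel f g};
  homeo_invK : {in B, cancel g f};
  homeo_cont : {within A, continuous f};
  homeo_inv_cont : {within B, continuous g} }.

Record is_vector_space (R : realType) (Y : Type) (F : set Y)
    (add : Y -> Y -> Y) (scale : R -> Y -> Y) : Prop := {
  vs_add_closed : forall x y, F x -> F y -> F (add x y);
  vs_scale_closed : forall a x, F x -> F (scale a x);
  vs_addA : forall x y z, F x -> F y -> F z ->
    add x (add y z) = add (add x y) z;
  vs_addC : forall x y, F x -> F y -> add x y = add y x;
  vs_zero_opp : exists zero, [/\ F zero,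
    forall x, F x -> add zero x = x &
    forall x, F x -> exists2 y, F y & add x y = zero];
  vs_scaleA : forall a b x, F x -> scale a (scale b x) = scale (a * b) x;
  vs_scale1 : forall x, F x -> scale 1 x = x;
  vs_scaleDr : forall a x y, F x -> F y ->
    scale a (add x y) = add (scale a x) (scale a y);
  vs_scaleDl : forall a b x, F x ->
    scale (a + b) x = add (scale a x) (scale b x) }.

Definition fiber (X Y : Type) (E : set Y) (p : Y -> X) (b : X) : set Y :=
  [set y | E y /\ p y = b].

(* Real topological vector bundle of rank r with base B, total space E and
   projection p, where B and E carry subspace topologies and [add b], [scale b]
   are the operations on the fiber over b. *)
Record is_vector_bundle (R : realType) (X Y : topologicalType) (r : nat)
    (B : set X) (E : set Y) (p : Y -> X)
    (add : X -> Y -> Y -> Y) (scale : X -> R -> Y -> Y) : Prop := {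
  vb_proj_image : p @` E = B;
  vb_proj_cont : {within E, continuous p};
  vb_fiber : forall b, B b ->
    is_vector_space (fiber E p b) (add b) (scale b);
  vb_local_triviality : forall b, B b ->
    exists (U : set X) (h : Y -> X * 'rV[R]_r) (g : X * 'rV[R]_r -> Y),
      [/\ open U, U b,
          homeomorphism_between (E `&` p @^-1` U) ((B `&` U) `*` setT) h g,
          forall y, (E `&` p @^-1` U) y -> (h y).1 = p y &
          forall c, (B `&` U) c ->
            (forall x y, fiber E p c x -> fiber E p c y ->
               (h (add c x y)).2 = (h x).2 + (h y).2) /\
            (forall a x, fiber E p c x ->
               (h (scale c a x)).2 = a *: (h x).2)] }.

Definition nu_add (R : realType) (d : nat) (xi : 'rV[R]_d)
    (z w : 'rV[R]_d * 'rV[R]_d) : 'rV[R]_d * 'rV[R]_d :=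
  (xi, z.2 + w.2).

Definition nu_scale (R : realType) (d : nat) (xi : 'rV[R]_d) (a : R)
    (z : 'rV[R]_d * 'rV[R]_d) : 'rV[R]_d * 'rV[R]_d :=
  (xi, a *: z.2).

Definition calE_add (R : realType) (d : nat) (M : set 'rV[R]_d)
    (xi x y : 'rV[R]_d) : 'rV[R]_d :=
  sigma_inv M (nu_add xi (sigma M x) (sigma M y)).

Definition calE_scale (R : realType) (d : nat) (M : set 'rV[R]_d)
    (xi : 'rV[R]_d) (a : R) (x : 'rV[R]_d) : 'rV[R]_d :=
  sigma_inv M (nu_scale xi a (sigma M x)).

(* Main.v *)
Require Import Defs.
From HB Require Import structures.
From mathcomp Require Import all_boot all_order all_algebra.
From mathcomp Require Import all_classical all_reals all_analysis.
From mathcomp Require Import ring lra.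
Set Implicit Arguments.
Unset Strict Implicit.
Unset Printing Implicit Defensive.
Import Order.TTheory GRing.Theory Num.Theory.
Import numFieldNormedType.Exports.
Local Open Scope classical_set_scope.
Local Open Scope ring_scope.

(* Write [xi] closest to [xi + v] as the linear condition
   2 <v, z - xi> <= |z - xi|^2 for all z in M ([prox]), and let kappa(xi, v) be
   the least t >= 0 such that 2 <v, z - xi> <= t |z - xi|^2 for all z in M; it
   is the reciprocal of the frontier function, made homogeneous in v.  Then
   nu_star is {kappa < 1}, phi is v |-> v / (1 - kappa v) and its inverse is
   w |-> w / (1 + kappa w), so everything reduces to the continuity of kappa.
   Lower semicontinuity holds because kappa is a supremum of continuous
   functions.  Upper semicontinuity, and the fact that kappa(xi, v) < 1 puts
   xi + v in the interior of unpp, follow from a second order estimate in a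
   chart: if kappa(xi, v) < 1, then
   2 <v1, x2 - x1> <= (1 - c) |x2 - x1|^2 with c > 0, for all x1, x2 in M near
   xi and all v1 near v normal to M at x1.  Conversely, if xi + v lies in the
   interior of unpp, then xi remains closest to the points slightly beyond
   xi + v on the ray from xi, because the distance to M has slope 1 there. *)

(** * Euclidean geometry *)

(** [M] need not be closed, so a point may have no closest point in [M]. Closest points are
    therefore found in the closure, to which [prox] extends, and brought back into [M] by the local
    closedness that charts give. The factor [1 + e] in front of [v] is a quantitative form of
    strictness: it leaves a gap proportional to [|z - xi|^2], which can survive a perturbation of
    both [xi] and [v]. Away from [xi], compactness suffices. Close to it both sides of the
    inequality are quadratically small, so plain continuity says nothing there; this is why the
    Taylor remainders at two base points are compared with an error [eta * |h|^2], and why second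
    derivatives are used. *)

Lemma cvg_bigsum (R : realType) (V : normedModType R) (I : Type) (r : seq I)
    (T : Type) (F : set_system T) {FF : Filter F} (f : I -> T -> V) (l : I -> V) :
  (forall i, f i @ F --> l i) ->
  \sum_(i <- r) f i x @[x --> F] --> \sum_(i <- r) l i.
Proof.
move=> fl; elim: r => [|i r IH].
  by rewrite big_nil; under eq_fun do rewrite big_nil; exact: cvg_cst.
by rewrite big_cons; under eq_fun do rewrite big_cons; exact: cvgD.
Qed.

Lemma near_lt (R : realType) (T : Type) (F : set_system T) {FF : Filter F}
    (f g : T -> R) (a b : R) :
  f @ F --> a -> g @ F --> b -> a < b -> \forall x \near F, f x < g x.
Proof.
move=> fa gb; rewrite -subr_gt0 => ab.
by near=> x; rewrite -subr_gt0; near: x; exact: (cvgr_gt _ (cvgB gb fa) _ ab).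
Unshelve. all: by end_near. Qed.

Lemma near_at_right (R : realType) (a : R) (P : set R) :
  (\forall t \near a, P t) -> \forall t \near a^'+, P t.
Proof. by move=> aP; apply: cvg_within; exact: aP. Qed.

Section Euclidean.
Context {R : realType} {d : nat}.
Implicit Types (u v w x y : 'rV[R]_d) (a b t : R).

Lemma dotC u v : dot u v = dot v u.
Proof. by apply: eq_bigr => i _; rewrite mulrC. Qed.

Lemma dotDl u v w : dot (u + v) w = dot u w + dot v w.
Proof. by rewrite -big_split; apply: eq_bigr => i _; rewrite mxE mulrDl. Qed.

Lemma dotZl a u v : dot (a *: u) v = a * dot u v.
Proof. by rewrite mulr_sumr; apply: eq_bigr => i _; rewrite mxE mulrA. Qed.

Lemma dotNl u v : dot (- u) v = - dot u v.
Proof. by rewrite -scaleN1r dotZl mulN1r. Qed.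

Lemma dotBl u v w : dot (u - v) w = dot u w - dot v w.
Proof. by rewrite dotDl dotNl. Qed.

Lemma dotDr u v w : dot w (u + v) = dot w u + dot w v.
Proof. by rewrite ![dot w _]dotC dotDl. Qed.

Lemma dotZr a u v : dot v (a *: u) = a * dot v u.
Proof. by rewrite ![dot v _]dotC dotZl. Qed.

Lemma dotNr u v : dot v (- u) = - dot v u.
Proof. by rewrite ![dot v _]dotC dotNl. Qed.

Lemma dotBr u v w : dot w (u - v) = dot w u - dot w v.
Proof. by rewrite dotDr dotNr. Qed.

Lemma dot0l u : dot 0 u = 0.
Proof. by rewrite -(scale0r u) dotZl mul0r. Qed.

Lemma dot0r u : dot u 0 = 0.
Proof. by rewrite dotC dot0l. Qed.

Lemma dot_lincombr u (I : finType) (c : I -> R) (f : I -> 'rV[R]_d) :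
  dot u (\sum_i c i *: f i) = \sum_i c i * dot u (f i).
Proof.
rewrite /dot; under [RHS]eq_bigr do rewrite mulr_sumr.
rewrite exchange_big; apply: eq_bigr => l _; rewrite summxE mulr_sumr.
by apply: eq_bigr => i _; rewrite mxE mulrCA.
Qed.

Definition dotE := (dotDl, dotDr, dotBl, dotBr, dotNl, dotNr, dotZl, dotZr).

Lemma dot_ge0 u : 0 <= dot u u.
Proof. by apply: sumr_ge0 => i _; rewrite -expr2 sqr_ge0. Qed.

Lemma norm_coord_le u i : `|u ord0 i| <= `|u|.
Proof.
rewrite [leRHS]/Num.norm/= mx_normrE.
by apply/bigmax_geP; right => /=; exists (ord0, i).
Qed.

Lemma norm_le_coord u (c : R) : 0 <= c -> (forall i, `|u ord0 i| <= c) ->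
  `|u| <= c.
Proof.
move=> c0 uc; rewrite /Num.norm/= mx_normrE.
by apply/bigmax_leP; split => //= -[i j] _ /=; rewrite (ord1 i).
Qed.

Lemma enorm_ge0 u : 0 <= enorm u.
Proof. exact: sqrtr_ge0. Qed.

Lemma sqr_enorm u : enorm u ^+ 2 = dot u u.
Proof. by rewrite sqr_sqrtr ?dot_ge0. Qed.

Lemma norm_le_enorm u : `|u| <= enorm u.
Proof.
apply: norm_le_coord; first exact: enorm_ge0.
move=> i; rewrite -sqrtr_sqr ler_sqrt ?dot_ge0//.
rewrite /dot (bigD1 i)//= -expr2 lerDl.
by apply: sumr_ge0 => j _; rewrite -expr2 sqr_ge0.
Qed.

Lemma sqr_norm_le_dot u : `|u| ^+ 2 <= dot u u.
Proof. by rewrite -sqr_enorm lerXn2r ?nnegrE ?enorm_ge0 ?norm_le_enorm. Qed.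

Lemma dot_le_norm u v : `|dot u v| <= d%:R * (`|u| * `|v|).
Proof.
apply: (le_trans (ler_norm_sum _ _ _)).
have -> : d%:R * (`|u| * `|v|) = \sum_(i < d) (`|u| * `|v|).
  by rewrite sumr_const card_ord mulr_natl.
apply: ler_sum => i _; rewrite normrM.
by rewrite ler_pM ?normr_ge0 ?norm_coord_le.
Qed.

Lemma dot_eq0 u : dot u u = 0 -> u = 0.
Proof.
move=> u0; apply/normr0_eq0/eqP; rewrite -sqrf_eq0 eq_le sqr_ge0 andbT.
by rewrite -u0 sqr_norm_le_dot.
Qed.

Lemma dot_gt0 u : u != 0 -> 0 < dot u u.
Proof.
by rewrite lt_def dot_ge0 andbT; apply: contra_neq; exact: dot_eq0.
Qed.

Lemma enorm_gt0 u : u != 0 -> 0 < enorm u.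
Proof. by move=> u0; rewrite sqrtr_gt0 dot_gt0. Qed.

Lemma enormZ a u : 0 <= a -> enorm (a *: u) = a * enorm u.
Proof.
move=> a0; rewrite /enorm !dotE mulrA -expr2 sqrtrM ?sqr_ge0// sqrtr_sqr.
by rewrite ger0_norm.
Qed.

Lemma enorm_le u v : (enorm u <= enorm v) = (dot u u <= dot v v).
Proof. by rewrite ler_sqrt ?dot_ge0. Qed.

Lemma enorm_lt u v : (enorm u < enorm v) = (dot u u < dot v v).
Proof. by rewrite !ltNge enorm_le. Qed.

Lemma cauchy_schwarz u v : dot u v <= enorm u * enorm v.
Proof.
have [->|u0] := eqVneq u 0; first by rewrite dot0l mulr_ge0 ?enorm_ge0.
have [->|v0] := eqVneq v 0; first by rewrite dot0r mulr_ge0 ?enorm_ge0.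
have := dot_ge0 (enorm u *: v - enorm v *: u).
rewrite !dotE -!sqr_enorm (dotC v u).
have := enorm_gt0 u0; have := enorm_gt0 v0.
set p := enorm u; set q := enorm v; set r := dot u v => q0 p0 h.
(* The squared length in [h] equals this product, whose first factor is positive. *)
have : 0 <= (2 * (p * q)) * (p * q - r).
  by apply: le_trans h _; rewrite le_eqVlt; apply/orP; left; apply/eqP; ring.
by rewrite pmulr_rge0 ?subr_ge0// !mulr_gt0.
Qed.

Lemma enormD u v : enorm (u + v) <= enorm u + enorm v.
Proof.
rewrite -(@ler_pXn2r _ 2)// ?nnegrE ?addr_ge0 ?enorm_ge0//.
rewrite sqr_enorm !dotE (dotC v u) sqrrD !sqr_enorm.
by have := cauchy_schwarz u v; lra.
Qed.

Lemma cvg_coord (T : Type) (F : set_system T) {FF : Filter F}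
    (f : T -> 'rV[R]_d) u i :
  f @ F --> u -> f x ord0 i @[x --> F] --> u ord0 i.
Proof. by move=> fu; exact: (cvg_comp _ _ fu (@coord_continuous _ _ _ _ _ u)). Qed.

Lemma cvg_rV (T : Type) (F : set_system T) {FF : Filter F}
    (f : T -> 'rV[R]_d) u :
  (forall i, f x ord0 i @[x --> F] --> u ord0 i) -> f @ F --> u.
Proof.
move=> fu; apply/cvgrPdist_le => e e0.
have : \forall x \near F, forall i, `|u ord0 i - f x ord0 i| <= e.
  by apply: filter_forall => i; move/cvgrPdist_le: (fu i) => /(_ _ e0).
apply: filterS => x ux; apply: norm_le_coord; first exact: ltW.
by move=> i; rewrite !mxE.
Qed.

Lemma cvg_dot (T : Type) (F : set_system T) {FF : Filter F}
    (f g : T -> 'rV[R]_d) u v :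
  f @ F --> u -> g @ F --> v -> dot (f x) (g x) @[x --> F] --> dot u v.
Proof.
move=> fu gv; apply: cvg_bigsum => i; apply: cvgM.
  exact: cvg_coord.
exact: cvg_coord.
Qed.

Lemma cvg_enorm (T : Type) (F : set_system T) {FF : Filter F}
    (f : T -> 'rV[R]_d) u :
  f @ F --> u -> enorm (f x) @[x --> F] --> enorm u.
Proof.
move=> fu; apply: (cvg_comp _ _ (cvg_dot fu fu)).
exact: sqrt_continuous.
Qed.

End Euclidean.

(** * Closest points *)

Definition prox (R : realType) (d : nat) (M : set 'rV[R]_d) (xi v : 'rV[R]_d) :=
  forall z, M z -> 2 * dot v (z - xi) <= dot (z - xi) (z - xi).

Section NearestPoints.
Context {R : realType} {d : nat}.
Variable M : set 'rV[R]_d.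
Implicit Types (u v w x y z xi : 'rV[R]_d) (a b e t : R).

Lemma cvg_subl x z : y - z @[y --> x] --> x - z.
Proof. exact: (cvgB (@cvg_id _ (nbhs x)) (cvg_cst z)). Qed.

Lemma cvg_subr x z : x - y @[y --> z] --> x - z.
Proof. exact: (cvgB (cvg_cst x) (@cvg_id _ (nbhs z))). Qed.

(** Expanding [|v - (z - xi)|^2] cancels [|v|^2]; comparing distances from [xi + v] thus becomes a
    condition linear in [v]. *)
Lemma dot_sub_le v z xi :
  (dot v v <= dot (xi + v - z) (xi + v - z)) =
  (2 * dot v (z - xi) <= dot (z - xi) (z - xi)).
Proof.
have -> : xi + v - z = v - (z - xi) by rewrite opprB addrA (addrC v).
move: (z - xi) => w; rewrite !dotE (dotC w v).
by apply/idP/idP; lra.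
Qed.

Lemma proxP xi v : prox M xi v <->
  forall z, M z -> dot v v <= dot (xi + v - z) (xi + v - z).
Proof. by split=> h z Mz; have := h z Mz; rewrite dot_sub_le. Qed.

Lemma nearestP x xi : nearest M x xi <->
  M xi /\ forall z, M z -> dot (x - xi) (x - xi) <= dot (x - z) (x - z).
Proof.
have lb : has_lbound [set enorm (x - z) | z in M].
  by exists 0 => _ [z _ <-]; exact: enorm_ge0.
split=> -[Mxi h]; split=> //.
  move=> z Mz; rewrite -enorm_le h; apply: ge_inf => //.
  by exists z.
apply/eqP; rewrite eq_le; apply/andP; split.
  apply: lb_le_inf; first by exists (enorm (x - xi)); exists xi.
  by move=> _ [z Mz <-]; rewrite enorm_le h.
by apply: ge_inf => //; exists xi.
Qed.

Lemma nearest_prox x xi : nearest M x xi <-> M xi /\ prox M xi (x - xi).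
Proof.
split=> [/nearestP[Mxi h]|[Mxi /proxP h]].
  by split=> //; apply/proxP => z Mz; rewrite subrKC; exact: h.
by apply/nearestP; split=> // z /h; rewrite subrKC.
Qed.

(** Both sides are continuous in [z]. This stands in for closedness of [M] when competitors range
    over the closure. *)
Lemma prox_closure xi v : prox M xi v -> prox (closure M) xi v.
Proof.
move=> h z Mz; rewrite leNgt; apply/negP => lt.
have yxi := @cvg_subl z xi.
have nlt : \forall y \near z, dot (y - xi) (y - xi) < 2 * dot v (y - xi).
  apply: near_lt (cvg_dot yxi yxi) _ lt.
  exact: cvgM (cvg_cst (2 : R)) (cvg_dot (cvg_cst v) yxi).
by have [y [/h yM]] := Mz _ nlt; rewrite /= ltNge yM.
Qed.

Lemma prox_scale xi v t : 0 <= t <= 1 -> prox M xi v -> prox M xi (t *: v).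
Proof.
move=> /andP[t0 t1] h z Mz; rewrite dotZl mulrCA.
apply: (le_trans (ler_wpM2l t0 (h _ Mz))).
by rewrite ler_piMl// dot_ge0.
Qed.

Lemma prox0 xi : prox M xi 0.
Proof. by move=> z _; rewrite dot0l mulr0 dot_ge0. Qed.

Lemma nearest_closure x xi z : nearest M x xi -> closure M z ->
  dot (x - xi) (x - xi) <= dot (x - z) (x - z).
Proof.
move=> /nearest_prox[_ /prox_closure h] /h.
by rewrite -dot_sub_le subrKC.
Qed.

Lemma unpp_nearest x : unpp M x -> nearest M x (metric_proj M x).
Proof. by move=> [xi [nxi _]]; apply: xgetPex; exists xi. Qed.

Lemma metric_proj_eq x xi : unpp M x -> nearest M x xi -> metric_proj M x = xi.
Proof.
by move=> ux nxi; have := unpp_nearest ux; move: ux nxi => [y [_ h]] /h <- /h.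
Qed.

(** On the compact part of the closure outside the [e]-ball around [xi], the strict inequality
    persists uniformly for [y] near [x]; remote points are excluded by the triangle inequality. *)
Lemma far_from_nearest x xi e :
    (forall z, closure M z -> z <> xi -> dot (x - xi) (x - xi) < dot (x - z) (x - z)) ->
    0 < e ->
  \forall y \near x, forall z, closure M z -> e <= `|z - xi| ->
    dot (y - xi) (y - xi) < dot (y - z) (y - z).
Proof.
move=> h e0.
(* If [|y - x| < 1] and [|z - x| > r], then [|y - z| > enorm (x - xi) + 1], which exceeds
   [enorm (y - xi)] for [y] near [x]. *)
pose r := enorm (x - xi) + 2.
pose K := closure M `&` [set z | e <= `|z - xi|] `&` [set z | `|z - x| <= r].
have cK : compact K.
  apply: bounded_closed_compact.
    exists (r + `|x|); split; first exact: num_real.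
    move=> b rb z [_ /= zr]; apply: le_trans (ltW rb).
    by rewrite -[z in leLHS](subrK x) (le_trans (ler_normD _ _))// lerD.
  apply: closedI; first apply: closedI; first exact: closed_closure.
    have -> : [set z | e <= `|z - xi|] = (fun z => `|z - xi|) @^-1` [set t | e <= t].
      by [].
    apply: closed_comp; last exact: closed_ge.
    by move=> z _; exact: (cvg_norm (@cvg_subl _ _)).
  have -> : [set z | `|z - x| <= r] = (fun z => `|z - x|) @^-1` [set t | t <= r].
    by [].
  apply: closed_comp; last exact: closed_le.
  by move=> z _; exact: (cvg_norm (@cvg_subl _ _)).
have nearK : \forall y \near x, K `<=` [set z | dot (y - xi) (y - xi) < dot (y - z) (y - z)].
  apply: ((compact_near_coveringP K).1 cK _ (nbhs x)
    (fun y z => dot (y - xi) (y - xi) < dot (y - z) (y - z))) => z [[Mz ez] _].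
  have zxi : z <> xi.
    by move=> zxi; move: ez; rewrite /= zxi subrr normr0 leNgt e0.
  have lt := h _ Mz zxi.
  have c1 : p.1 @[p --> (z, x)] --> z by exact: cvg_fst.
  have c2 : p.2 @[p --> (z, x)] --> x by exact: cvg_snd.
  have c3 : p.2 - p.1 @[p --> (z, x)] --> x - z by exact: cvgB c2 c1.
  have c4 : p.2 - xi @[p --> (z, x)] --> x - xi by exact: cvgB c2 (cvg_cst xi).
  have nlt : \forall p \near (z, x),
      dot (p.2 - xi) (p.2 - xi) < dot (p.2 - p.1) (p.2 - p.1).
    exact: (near_lt (cvg_dot c4 c4) (cvg_dot c3 c3) lt).
  exact: nlt.
have near1 : \forall y \near x, enorm (y - xi) < enorm (x - xi) + 1.
  by apply: (cvgr_lt _ (cvg_enorm (@cvg_subl x xi))); rewrite ltrDl.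
have near2 : \forall y \near x, `|y - x| < 1.
  by have /cvgrPdist_lt/(_ _ ltr01) := @cvg_id _ (nbhs x); apply: filterS => y; rewrite distrC.
near=> y => z Mz ez.
have [zr|zr] := leP `|z - x| r; first by apply: (near nearK y).
have n1 : enorm (y - xi) < enorm (x - xi) + 1 by near: y.
have n2 : `|y - x| < 1 by near: y.
rewrite -enorm_lt.
have := norm_le_enorm (y - z); rewrite -normrN opprB.
have := ler_normD (z - y) (y - x); rewrite addrA subrK /r in zr *.
by move=> *; lra.
Unshelve. all: by end_near. Qed.

(** The minimum over the compact set of closure points at most as far from [x] as a fixed point of
    [M] beats all other closure points too. *)
Lemma exists_closest x : M !=set0 -> exists2 z, closure M z &
  forall y, closure M y -> dot (x - z) (x - z) <= dot (x - y) (x - y).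
Proof.
move=> [z0 Mz0].
pose K := closure M `&` [set z | dot (x - z) (x - z) <= dot (x - z0) (x - z0)].
have cf : continuous (fun z => dot (x - z) (x - z)).
  by move=> z; exact: (cvg_dot (@cvg_subr _ _) (@cvg_subr _ _)).
have cK : compact K.
  apply: bounded_closed_compact.
    exists (enorm (x - z0) + `|x|); split; first exact: num_real.
    move=> b rb z [_ /=]; rewrite -enorm_le => zr; apply: le_trans (ltW rb).
    rewrite -[z in leLHS](subrK x) (le_trans (ler_normD _ _))// lerD//.
    by rewrite -normrN opprB (le_trans (norm_le_enorm _)).
  apply: closedI; first exact: closed_closure.
  apply: (@closed_comp _ _ (fun z => dot (x - z) (x - z)) [set t | t <= dot (x - z0) (x - z0)]).
    by move=> z _; exact: cf.
  exact: closed_le.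
have [||z /set_mem[Mz zz0] zmin] := @EVT_min_rV _ _ (fun z => dot (x - z) (x - z)) K _ cK.
- by exists z0; split=> //=; exact: subset_closure.
- exact: continuous_subspaceT.
- exists z => // y My; have [yz0|/ltW yz0] := leP (dot (x - y) (x - y)) (dot (x - z0) (x - z0)).
    by apply: zmin; apply/mem_set; split.
  exact: le_trans zz0 yz0.
Qed.

Lemma cvg_line x u : x + t *: u @[t --> (0 : R)] --> x.
Proof.
rewrite -[in X in _ --> X](addr0 x) -(scale0r u).
by apply: cvgD; [exact: cvg_cst | apply: cvgZr_tmp].
Qed.

(* A second closest point [z] of the closure would be, by moving [x] slightly
   towards [z], the only closest point of the closure, hence would lie in [M]. *)
Lemma calE_closest_unique x xi z : calE M x -> nearest M x xi -> closure M z ->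
  z <> xi -> dot (x - xi) (x - xi) < dot (x - z) (x - z).
Proof.
move=> Ex nxi Mz zxi; rewrite ltNge; apply/negP => le; apply: zxi.
have pz : prox M z (x - z).
  apply/proxP => y My; rewrite subrKC.
  by move/nearestP : nxi => [_ /(_ _ My)]; exact: le_trans.
suff Mz' : M z.
  have ux : unpp M x := interior_subset Ex.
  rewrite -(metric_proj_eq ux nxi); apply/esym/metric_proj_eq => //.
  by apply/nearest_prox.
have : \forall t \near (0 : R)^'+, unpp M (x + t *: (z - x)).
  by apply: cvg_within; apply: (@cvg_line x (z - x)); exact: Ex.
move=> near_unpp.
have [t [[ut t0] t1]] : exists t, (unpp M (x + t *: (z - x)) /\ 0 < t) /\ t < 1.
  near (0 : R)^'+ => t; exists t; split; first split; first by near: t.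
    by [].
  by near: t; exact: nbhs_right_lt.
have := unpp_nearest ut; move: (metric_proj _ _) => y ny.
have := nearest_closure ny Mz; have [/pz yz _] := (nearest_prox _ _).1 ny.
have -> : x + t *: (z - x) - y = (1 - t) *: (x - z) - (y - z).
  by apply/rowP => i; rewrite !mxE; ring.
have -> : x + t *: (z - x) - z = (1 - t) *: (x - z).
  by apply/rowP => i; rewrite !mxE; ring.
move: (ny) => [My _].
(* With [a = x - z] and [b = y - z], [pz] gives [2 <a, b> <= |b|^2], so [|(1 - t) a - b|^2 >= |(1 -
   t) a|^2 + t |b|^2]. Hence [y], closest to the moved point, must be [z]. *)
suff H : y - z != 0 -> dot ((1 - t) *: (x - z) - (y - z)) ((1 - t) *: (x - z) - (y - z)) >
   dot ((1 - t) *: (x - z)) ((1 - t) *: (x - z)).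
  move=> le2; have [/eqP|/H] := eqVneq (y - z) 0; first by rewrite subr_eq0 => /eqP <-.
  by rewrite ltNge le2.
move=> /dot_gt0; move: yz.
move: (x - z) (y - z) => a b; rewrite !dotE (dotC b a).
move: (dot a b) (dot b b) (dot a a) => p q r; nra.
Unshelve. all: by end_near. Qed.

(** If the projection of a nearby [y] were at distance at least [e] from that of [x], the latter
    would be strictly closer to [y], by [far_from_nearest]. *)
Lemma metric_proj_continuous x : calE M x -> {for x, continuous (metric_proj M)}.
Proof.
move=> Ex; have nx := unpp_nearest (interior_subset Ex).
apply/(@cvgrPdist_lt _ _ _ (nbhs x)) => e e0.
have far := @far_from_nearest x _ e (fun z => @calE_closest_unique x _ z Ex nx) e0.
have near_unpp : \forall y \near x, unpp M y by exact: Ex.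
near=> y.
have uy : unpp M y by near: y.
have : forall z, closure M z -> e <= `|z - metric_proj M x| ->
    dot (y - metric_proj M x) (y - metric_proj M x) < dot (y - z) (y - z).
  by near: y; exact: far.
have ny := unpp_nearest uy.
move=> /(_ _ (subset_closure ny.1)); rewrite -normrN opprB ltNge [_ < e]ltNge => fy.
apply/negP => /fy /negP; apply.
by move/nearestP : ny => [_ /(_ _ nx.1)].
Unshelve. all: by end_near. Qed.

End NearestPoints.

(** * Extension of the ray from the projection *)

Section Extension.
Context {R : realType} {d : nat}.
Variable M : set 'rV[R]_d.
Implicit Types (u v w x y z xi : 'rV[R]_d) (a b e t : R).

(* On [calE M], the distance to [M]; a variable, as unification diverges on its
   unfolding. *)
Variable delta : 'rV[R]_d -> R.
Hypothesis deltaE : forall z, delta z = enorm (z - metric_proj M z).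

Let cvg_delta z (T : Type) (F : set_system T) {FF : Filter F} (f : T -> 'rV[R]_d) :
  f x - metric_proj M (f x) @[x --> F] --> z - metric_proj M z ->
  delta (f x) @[x --> F] --> delta z.
Proof. by move=> fz; rewrite deltaE; under eq_fun do rewrite deltaE; exact: cvg_enorm. Qed.

Let cvg_res z u : calE M z ->
  z + h *: u - metric_proj M (z + h *: u) @[h --> (0 : R)] --> z - metric_proj M z.
Proof.
move=> Ez; have czh := @cvg_line R d z u.
exact: cvgB czh (cvg_comp _ _ czh (metric_proj_continuous Ez)).
Qed.

(** Let [w] be the residual of [z + h *: u]. Its foot lies in [M], so
    [delta z ^ 2 <= |w - h *: u|^2], that is, [(|w| - delta z) (|w| + delta z) >= h (2 <u, w> - h)].
    By continuity of the projection, [<u, w>] and [|w|] tend to [delta z], so the difference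
    quotient is eventually above any [eta < 1]. *)
Let delta_slope z eta : calE M z -> 0 < delta z -> 0 <= eta < 1 ->
  let u := (delta z)^-1 *: (z - metric_proj M z) in
  enorm u = 1 /\
  \forall h \near (0 : R)^'+, eta * h < delta (z + h *: u) - delta z.
Proof.
move=> Ez dz0 /andP[eta0 eta1] u.
have u1 : enorm u = 1.
  by rewrite enormZ ?invr_ge0 ?ltW// -(deltaE z) mulVf// gt_eqF.
have uz : dot u (z - metric_proj M z) = delta z.
  by rewrite dotZl -sqr_enorm -(deltaE z) expr2 mulrA mulVf ?mul1r ?gt_eqF.
clearbody u; split=> //.
have cres := @cvg_res z u Ez.
have near_D : \forall h \near (0 : R), eta * (delta (z + h *: u) + delta z) <
    2 * dot u (z + h *: u - metric_proj M (z + h *: u)) - h.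
  have c1 : eta * (delta (z + h *: u) + delta z) @[h --> (0 : R)] -->
      eta * (delta z + delta z).
    exact: cvgM (cvg_cst eta) (cvgD (cvg_delta cres) (cvg_cst (delta z))).
  have c2 : 2 * dot u (z + h *: u - metric_proj M (z + h *: u)) - h
      @[h --> (0 : R)] --> 2 * dot u (z - metric_proj M z) - 0.
    exact: cvgB (cvgM (cvg_cst (2 : R)) (cvg_dot (cvg_cst u) cres)) cvg_id.
  apply: near_lt c1 c2 _.
  rewrite uz; have := dz0; move: (delta z) => D D0; nra.
have near_E : \forall h \near (0 : R), calE M (z + h *: u).
  have nE : nbhs z (calE M) by apply: (open_nbhs_nbhs (conj (@open_interior _ _) Ez)).
  exact: (@cvg_line R d z u _ nE).
near=> h.
have h0 : 0 < h by [].
have Dh : eta * (delta (z + h *: u) + delta z) <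
    2 * dot u (z + h *: u - metric_proj M (z + h *: u)) - h.
  by near: h; exact: near_at_right near_D.
have Eh : calE M (z + h *: u) by near: h; exact: near_at_right near_E.
have [Mh _] := unpp_nearest (interior_subset Eh).
have [_ /(_ _ Mh)] := (nearestP _ _ _).1 (unpp_nearest (interior_subset Ez)).
move: Dh; rewrite (deltaE (z + _)); set w := z + h *: u - metric_proj M (z + h *: u).
have -> : z - metric_proj M (z + h *: u) = w - h *: u.
  by apply/rowP => i; rewrite /w !mxE; ring.
clearbody w; rewrite -[dot (z - _) _]sqr_enorm -(deltaE z) !dotE.
rewrite -(sqr_enorm u) u1 -(sqr_enorm w) (dotC w u).
have := enorm_ge0 w; have := dz0.
move: (enorm w) (delta z) (dot u w) => W D p D0 W0 H1 H2.
rewrite ltNge; apply/negP => H3.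
have : (W - D) * (W + D) <= eta * h * (W + D).
  by apply: ler_wpM2r => //; lra.
have : h * (eta * (W + D)) < h * (2 * p - h) by rewrite ltr_pM2l.
by nra.
Unshelve. all: by end_near. Qed.

Let compact_eball x r : compact [set z | enorm (z - x) <= r].
Proof.
apply: bounded_closed_compact.
  exists (r + `|x|); split; first exact: num_real.
  move=> b rb z /= zr; apply: le_trans (ltW rb).
  rewrite -[z in leLHS](subrK x) (le_trans (ler_normD _ _))// lerD//.
  exact: le_trans (norm_le_enorm _) zr.
apply: (@closed_comp _ _ (fun z => enorm (z - x)) [set t | t <= r]).
  by move=> z _; exact: (cvg_enorm (@cvg_subl _ _ z x)).
exact: closed_le.
Qed.

(* For [eta < 1], a maximiser of [delta z - eta * |z - x|] on a ball around [x]
   lies on the boundary, as [delta] has slope 1 everywhere; hence the maximum of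
   [delta] on the ball is [delta x + r], attained on the ray from the
   projection of [x] through [x]. *)
Lemma ray_extends x : calE M x -> ~ M x ->
  exists2 e, 0 < e & prox M (metric_proj M x) ((1 + e) *: (x - metric_proj M x)).
Proof.
move=> Ex Mx; have nx := unpp_nearest (interior_subset Ex).
have dx0 : 0 < delta x.
  rewrite deltaE; apply: enorm_gt0; rewrite subr_eq0; apply/eqP => xp.
  by apply: Mx; rewrite xp; exact: nx.1.
have [r r0 rE] : exists2 r, 0 < r & forall z, enorm (z - x) <= r -> calE M z.
  have : nbhs x (calE M) by apply: (open_nbhs_nbhs (conj (@open_interior _ _) Ex)).
  move=> /nbhs_ballP[r /= r0 rE]; exists (r / 2); first by rewrite divr_gt0.
  move=> z zr; apply: rE; rewrite -ball_normE /= -normrN opprB.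
  by have := norm_le_enorm (z - x); lra.
pose B := [set z | enorm (z - x) <= r].
have Bx : B x by rewrite /B /= subrr -(scale0r x) enormZ// mul0r ltW.
have cdelta z : B z -> delta y @[y --> z] --> delta z.
  move=> /rE /metric_proj_continuous pz.
  exact: (@cvg_delta z _ (nbhs z) _ (fun y => y) (cvgB (@cvg_id _ (nbhs z)) pz)).
have Bmax eta : 0 <= eta < 1 -> exists2 z, B z & delta x + eta * r <= delta z.
  move=> eta01; have /andP[eta0 eta1] := eta01.
  have [||z /set_mem Bz zmax] := @EVT_max_rV _ _
      (fun z => delta z - eta * enorm (z - x)) B _ (@compact_eball x r).
  - by exists x.
  - apply: continuous_in_subspaceT => z /set_mem Bz.
    exact: cvgB (cdelta _ Bz) (cvgM (cvg_cst eta) (cvg_enorm (@cvg_subl _ _ z x))).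
  have enormxx : enorm (x - x) = 0 by rewrite subrr -(scale0r x) enormZ// mul0r.
  have dxz : delta x <= delta z - eta * enorm (z - x).
    have : delta x - eta * enorm (x - x) <= delta z - eta * enorm (z - x).
      by apply: zmax; exact: mem_set.
    by rewrite enormxx; move: (delta x) (delta z) (enorm _) => *; lra.
  exists z => //.
  have [zr|zr] := leP r (enorm (z - x)).
    have : eta * r <= eta * enorm (z - x) by rewrite ler_wpM2l.
    by lra.
  have Ez := rE _ Bz.
  have dz0 : 0 < delta z.
    by have := mulr_ge0 eta0 (enorm_ge0 (z - x)); lra.
  have [u1 slope] := delta_slope Ez dz0 eta01.
  move: u1 slope; set u := _ *: _ => u1 slope.
  exfalso; near (0 : R)^'+ => h.
  have h0 : 0 < h by [].
  have hsmall : h < r - enorm (z - x).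
    by near: h; apply: nbhs_right_lt; rewrite subr_gt0.
  have hslope : eta * h < delta (z + h *: u) - delta z by near: h.
  have zh : enorm (z + h *: u - x) <= enorm (z - x) + h.
    rewrite (_ : z + h *: u - x = z - x + h *: u); last by rewrite addrAC.
    by rewrite (le_trans (enormD _ _))// enormZ ?(ltW h0)// u1 mulr1.
  have Bzh : B (z + h *: u) by rewrite /B /=; lra.
  have := zmax _ (mem_set Bzh); have := ler_wpM2l eta0 zh; lra.
have [||y /set_mem By ymax] := @EVT_max_rV _ _ delta B _ (@compact_eball x r).
- by exists x.
- by apply: continuous_in_subspaceT => z /set_mem; exact: cdelta.
have dy : delta x + r <= delta y.
  have dyB eta : 0 <= eta < 1 -> delta x + eta * r <= delta y.
    by move=> /Bmax[z Bz] /le_trans; apply; exact: ymax (mem_set Bz).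
  rewrite leNgt; apply/negP => gap.
  pose g := delta x + r - delta y.
  have g0 : 0 < g by rewrite /g; lra.
  have gr : g <= r.
    have := dyB 0; rewrite lexx ltr01 => /(_ isT).
    by rewrite mul0r addr0 /g => le; lra.
  (* For this [eta], [delta x + eta * r = delta y + g / 2], contradicting [dyB]. *)
  have : 0 <= 1 - g / (2 * r) < 1.
    rewrite subr_ge0 gtrBl divr_gt0 ?mulr_gt0// andbT.
    by rewrite ler_pdivrMr ?mulr_gt0//; lra.
  move=> /dyB; rewrite mulrBl mul1r invfM mulrA mulfVK ?gt_eqF// /g.
  by rewrite /g in g0; lra.
have Ey := rE _ By.
have ny := unpp_nearest (interior_subset Ey).
(* Equality case of the triangle inequality: [y] is within [r] of [x] and at least [delta x + r]
   away from the projection of [x]. *)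
have yx : y = x + (r / delta x) *: (x - metric_proj M x).
  apply/eqP; rewrite -subr_eq0 opprD addrA; apply/eqP/dot_eq0/le_anti.
  rewrite dot_ge0 andbT.
  have : enorm (y - metric_proj M y) <= enorm (y - metric_proj M x).
    rewrite enorm_le; move/nearestP : ny => [_]; apply.
    exact: nx.1.
  rewrite -(deltaE y) => h.
  have {h} : (delta x + r) ^+ 2 <= enorm (y - metric_proj M x) ^+ 2.
    by rewrite ler_pXn2r// ?nnegrE ?enorm_ge0//; lra.
  have -> : y - metric_proj M x = (y - x) + (x - metric_proj M x).
    by rewrite addrA subrK.
  have := By; rewrite /B /= -(@ler_pXn2r _ 2)// ?nnegrE ?enorm_ge0 ?(ltW r0)//.
  rewrite !sqr_enorm; have := dx0.
  have : dot (x - metric_proj M x) (x - metric_proj M x) = delta x ^+ 2.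
    by rewrite deltaE sqr_enorm.
  move: (y - x) (x - metric_proj M x) (delta x) => a b D bD D0.
  rewrite !dotE bD.
  rewrite (dotC b a); move: (dot a a) (dot a b) => p q H1 H2.
  rewrite [leLHS](_ : _ = p - 2 * q * (r / D) + r ^+ 2); last first.
    by field; rewrite gt_eqF.
  have : 2 * (r * D) + r ^+ 2 - p <= 2 * q by nra.
  have rD : 0 < r / D by rewrite divr_gt0.
  move=> /(ler_wpM2r (ltW rD)).
  have -> : (2 * (r * D) + r ^+ 2 - p) * (r / D) =
      2 * r ^+ 2 + (r ^+ 2 - p) * (r / D) by field; rewrite gt_eqF.
  by nra.
exists (r / delta x); first exact: divr_gt0.
have -> : (1 + r / delta x) *: (x - metric_proj M x) = y - metric_proj M x.
  by rewrite yx scalerDl scale1r addrAC.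
(* Lying on the ray, [y] is at most [r + delta x <= delta y] away from the projection of [x], and
   [delta y] is its distance to [M]. *)
apply/proxP => z Mz; rewrite subrKC; apply: (@le_trans _ _ (dot (y - metric_proj M y) (y - metric_proj M y))).
  rewrite -enorm_le -(deltaE y) (le_trans _ dy)// yx addrAC.
  rewrite (le_trans (enormD _ _))// enormZ ?divr_ge0 ?(ltW r0) ?(ltW dx0)//.
  by rewrite -(deltaE x) mulfVK// gt_eqF.
by move/nearestP : ny => [_]; apply.
Unshelve. all: by end_near. Qed.

End Extension.

Lemma calE_ray_extends (R : realType) (d : nat) (M : set 'rV[R]_d) x :
  calE M x -> ~ M x ->
  exists2 e, 0 < e & prox M (metric_proj M x) ((1 + e) *: (x - metric_proj M x)).
Proof. by apply: ray_extends. Qed.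

(** * Strict differentiability and second order remainders *)

Lemma near_radius (R : realType) (V : normedModType R) (x0 : V) (P : set V) :
  (\forall x \near x0, P x) <-> exists2 r, 0 < r & forall x, `|x - x0| < r -> P x.
Proof.
split=> [/nbhs_ballP[r /= r0 rP]|[r r0 rP]].
  by exists r => // x xr; apply: rP; rewrite -ball_normE /= distrC.
by apply/nbhs_ballP; exists r => // x; rewrite -ball_normE /= distrC; exact: rP.
Qed.

Section Calculus.
Context {R : realType} {d : nat}.
Implicit Types (u v w x y z h : 'rV[R]_d) (a b e t : R).

Definition ebasis (i : 'I_d) : 'rV[R]_d := delta_mx ord0 i.

Lemma norm_lincomb_le (V : normedModType R) h (f : 'I_d -> V) (c : R) :
  (forall i, `|f i| <= c) -> `|\sum_i h ord0 i *: f i| <= d%:R * (`|h| * c).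
Proof.
move=> fc; apply: (le_trans (ler_norm_sum _ _ _)).
have -> : d%:R * (`|h| * c) = \sum_(i < d) (`|h| * c).
  by rewrite sumr_const card_ord mulr_natl.
apply: ler_sum => i _; rewrite normrZ.
by rewrite ler_pM ?normr_ge0 ?norm_coord_le.
Qed.

Lemma diff_ebasis (V : normedModType R) (F : 'rV[R]_d -> V) x h :
  'd F x h = \sum_i h ord0 i *: 'd F x (ebasis i).
Proof.
rewrite [h in LHS]row_sum_delta linear_sum.
by apply: eq_bigr => i _; rewrite linearZ.
Qed.

(** [Ck] controls ['d F x v] for one fixed [v] at a time; expansion in the basis turns finitely many
    such bounds into one uniform in [h], at the cost of a factor [d]. *)
Lemma norm_diffB_le (V : normedModType R) (F G : 'rV[R]_d -> V) x y h (c : R) :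
  (forall i, `|'d F x (ebasis i) - 'd G y (ebasis i)| <= c) ->
  `|'d F x h - 'd G y h| <= d%:R * (`|h| * c).
Proof.
move=> FGc; apply: le_trans (norm_lincomb_le h FGc).
rewrite le_eqVlt; apply/orP; left; apply/eqP; congr `|_|.
under eq_bigr do rewrite scalerBr.
by rewrite sumrB; congr (_ - _); exact: diff_ebasis.
Qed.

Lemma norm_diffBB_le (V : normedModType R) (F : 'rV[R]_d -> V) x y z w h (c : R) :
  (forall i, `|('d F x (ebasis i) - 'd F y (ebasis i)) -
               ('d F z (ebasis i) - 'd F w (ebasis i))| <= c) ->
  `|('d F x h - 'd F y h) - ('d F z h - 'd F w h)| <= d%:R * (`|h| * c).
Proof.
move=> Fc; apply: le_trans (norm_lincomb_le h Fc).
have lincombBB (f1 f2 f3 f4 : 'I_d -> V) :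
    \sum_i h ord0 i *: ((f1 i - f2 i) - (f3 i - f4 i)) =
    (\sum_i h ord0 i *: f1 i - \sum_i h ord0 i *: f2 i) -
    (\sum_i h ord0 i *: f3 i - \sum_i h ord0 i *: f4 i).
  by rewrite -!sumrB; apply: eq_bigr => i _; rewrite !scalerBr.
rewrite lincombBB le_eqVlt; apply/orP; left; apply/eqP.
by congr `|(_ - _) - (_ - _)|; exact: diff_ebasis.
Qed.

Lemma common_radius (P : 'I_d -> R -> Prop) :
  (forall i, exists2 r, 0 < r & P i r) ->
  (forall i r s, s <= r -> P i r -> P i s) ->
  exists2 r, 0 < r & forall i, P i r.
Proof.
move=> Pr Pmono; have nP : \forall r \near (0 : R)^'+, forall i, P i r.
  apply: filter_forall => i; have [r r0 Pir] := Pr i.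
  by near=> s; apply: Pmono Pir; near: s; exact: nbhs_right_le.
near (0 : R)^'+ => r; exists r; first by [].
by near: r.
Unshelve. all: by end_near. Qed.

Lemma is_derive_line (V : normedModType R) (F : 'rV[R]_d -> V) x h t :
  differentiable F (x + t *: h) ->
  is_derive t 1 (fun s => F (x + s *: h)) ('d F (x + t *: h) h).
Proof.
move=> dF; have dFh := derivableP (@diff_derivable _ _ _ _ _ h dF).
rewrite deriveE// in dFh; case: dFh => ex val.
have quot : (fun s : R => s^-1 *: (((fun s => F (x + s *: h)) \o shift t) (s *: 1)
      - F (x + t *: h))) =
    (fun s : R => s^-1 *: ((F \o shift (x + t *: h)) (s *: h) - F (x + t *: h))).
  apply/funext => s /=; congr (_ *: (F _ - _)).
  rewrite (_ : s *: 1 + t = s + t); last by congr (_ + _); exact: mulr1.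
  by rewrite scalerDl addrCA.
by split; [rewrite /derivable quot | rewrite /derive quot].
Qed.

(** The scalar mean value theorem in each coordinate; the sup norm makes this lossless although the
    intermediate points differ. *)
Lemma mean_value_le (f df : R -> 'rV[R]_d) (c : R) : 0 <= c ->
  (forall t, 0 <= t <= 1 -> is_derive t 1 f (df t)) ->
  (forall t, 0 <= t <= 1 -> `|df t| <= c) -> `|f 1 - f 0| <= c.
Proof.
move=> c0 fdf dfc; apply: norm_le_coord => // i.
have fidf t : 0 <= t <= 1 -> is_derive t 1 (fun s => f s ord0 i) (df t ord0 i).
  move=> /fdf[ft <-]; split; first by move/derivable_mxP : ft.
  by rewrite derive_mx// mxE.
have [||s s01] := @MVT_segment R (fun s => f s ord0 i) (fun s => df s ord0 i) 0 1 ler01.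
- by move=> t; rewrite in_itv /= => /andP[t0 t1]; apply: fidf; rewrite !ltW.
- apply: continuous_in_subspaceT => t; rewrite inE /= in_itv /= => t01.
  apply: differentiable_continuous; apply/derivable1_diffP.
  by have [] := fidf _ t01.
rewrite subr0 mulr1 !mxE => ->.
apply: le_trans (norm_coord_le _ _) _; apply: dfc.
by rewrite in_itv in s01.
Qed.

Lemma is_derive_scalel (V : normedModType R) (w : V) t :
  is_derive t 1 (fun s : R => s *: w) w.
Proof.
have dl := is_diff_scalel t w.
apply: DeriveDef; first exact/derivable1_diffP/ex_diff.
by rewrite deriveE ?ex_diff// diff_val scale1r.
Qed.

Variables (F : 'rV[R]_d -> 'rV[R]_d) (D : set 'rV[R]_d) (x0 : 'rV[R]_d).
Hypotheses (oD : open D) (Dx0 : D x0).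

Let seg_near (x y : 'rV[R]_d) (r t : R) : 0 <= t <= 1 -> `|x - x0| < r -> `|y - x0| < r ->
  `|x + t *: (y - x) - x0| < r.
Proof.
move=> /andP[t0 t1] xr yr.
have -> : x + t *: (y - x) - x0 = (1 - t) *: (x - x0) + t *: (y - x0).
  by apply/rowP => i; rewrite !mxE; ring.
apply: (le_lt_trans (ler_normD _ _)); rewrite !normrZ !ger0_norm ?subr_ge0//.
have := normr_ge0 (x - x0); have := normr_ge0 (y - x0).
move: `|_ - x0| `|_ - x0| xr yr => X Y *; have [XY|YX] := leP X Y; nra.
Qed.

(** The mean value inequality for [F (x + t *: (y - x)) - t *: 'd F x0 (y - x)], whose derivative is
    small because ['d F] is continuous at [x0]. *)
Lemma strict_diff (eta : R) : Ck 1 F D -> 0 < eta ->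
  exists2 r, 0 < r & forall x y, `|x - x0| < r -> `|y - x0| < r ->
    `|F y - F x - 'd F x0 (y - x)| <= eta * `|y - x|.
Proof.
move=> [dF cF] eta0.
(* The denominator absorbs the factor [d] of [norm_diffB_le]; the successor keeps it nonzero when
   [d = 0]. *)
pose e := eta / d.+1%:R.
have e0 : 0 < e by rewrite divr_gt0.
have : \forall x \near x0, D x /\ forall i,
    `|'d F x0 (ebasis i) - 'd F x (ebasis i)| <= e.
  have cont : \forall x \near nbhs x0, forall i,
      `|'d F x0 (ebasis i) - 'd F x (ebasis i)| <= e.
    apply: filter_forall => i.
    by move/cvgrPdist_le : (cF (ebasis i) _ Dx0) => /(_ _ e0).
  exact: (filterI (open_nbhs_nbhs (conj oD Dx0)) cont).
move=> /near_radius[r r0 rP]; exists r => // x y xr yr.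
have := @mean_value_le (fun t => F (x + t *: (y - x)) - t *: 'd F x0 (y - x))
  (fun t => 'd F (x + t *: (y - x)) (y - x) - 'd F x0 (y - x)) (eta * `|y - x|).
rewrite /= !scale1r !scale0r addr0 subr0 subrKC addrAC; apply.
- by rewrite mulr_ge0// ltW.
- move=> t t01; apply: is_deriveB.
  + by apply: is_derive_line; apply: dF; have [] := rP _ (seg_near t01 xr yr).
  + exact: is_derive_scalel.
move=> t t01; have [_ rxt] := rP _ (seg_near t01 xr yr).
apply: (@le_trans _ _ (d%:R * (`|y - x| * e))).
  by apply: norm_diffB_le => i; rewrite distrC; exact: rxt.
rewrite mulrCA mulrC ler_wpM2r// /e mulrCA ler_piMr ?(ltW eta0)//.
by rewrite ler_pdivrMr// mul1r ler_nat.
Qed.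

Lemma strict_diff_lipschitz : Ck 1 F D ->
  exists2 r, 0 < r & exists2 L, 0 < L & forall x y, `|x - x0| < r ->
    `|y - x0| < r -> `|F y - F x| <= L * `|y - x|.
Proof.
move=> cF; have [r r0 rF] := strict_diff cF ltr01.
exists r => //.
have [k k0 kd] := linear_lipschitz (diff_continuous (cF.1 _ Dx0)).
exists (k + 1); first by rewrite addr_gt0.
move=> x y xr yr; rewrite -(subrK ('d F x0 (y - x)) (F y - F x)).
apply: le_trans (ler_normD _ _) _; rewrite addrC mulrDl lerD//.
exact: rF.
Qed.

(** The remainder, not the polynomial: for a chart [Psi] and flat [h], what is left of a chord of
    [M] after subtracting the tangent vector ['d Psi x h]. *)
Definition taylor1 (x h : 'rV[R]_d) := F (x + h) - F x - 'd F x h.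

(** The mean value inequality is applied to the difference of the two remainders at once, so that
    only second differences of the derivative need to be small. *)
Lemma taylor1_near : Ck 2 F D -> exists2 r, 0 < r & forall x h,
  `|x - x0| < r -> `|h| < r -> forall c, 0 <= c ->
  (forall t, 0 <= t <= 1 -> forall i,
     `|('d F (x + t *: h) (ebasis i) - 'd F (x0 + t *: h) (ebasis i)) -
       ('d F x (ebasis i) - 'd F x0 (ebasis i))| <= c) ->
  `|taylor1 x h - taylor1 x0 h| <= d%:R * (`|h| * c).
Proof.
move=> [dF _].
have [r r0 rD] := (near_radius _ _).1 (open_nbhs_nbhs (conj oD Dx0)).
exists (r / 2) => [|x h xr hr c c0 xhc]; first by rewrite divr_gt0.
have inD y t : 0 <= t <= 1 -> `|y - x0| < r / 2 -> D (y + t *: h).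
  move=> /andP[t0 t1] yr; apply: rD; rewrite addrAC.
  apply: (le_lt_trans (ler_normD _ _)); rewrite normrZ ger0_norm//.
  by have := ler_piMl (normr_ge0 h) t1; lra.
pose g t := F (x + t *: h) - F (x0 + t *: h) - t *: ('d F x h - 'd F x0 h).
have -> : taylor1 x h - taylor1 x0 h = g 1 - g 0.
  have alg (a1 a2 a3 a4 u1 u2 : 'rV[R]_d) :
      a1 - a2 - u1 - (a3 - a4 - u2) = a1 - a3 - (u1 - u2) - (a2 - a4 - 0).
    by apply/rowP => i; rewrite !mxE; ring.
  by rewrite /g /taylor1 !scale1r !scale0r !addr0; exact: alg.
apply: (@mean_value_le _ (fun t => 'd F (x + t *: h) h - 'd F (x0 + t *: h) h -
    ('d F x h - 'd F x0 h))).
- by rewrite !mulr_ge0.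
- move=> t t01; apply: is_deriveB; first apply: is_deriveB.
  + by apply: is_derive_line; apply: dF; exact: inD.
  + by apply: is_derive_line; apply: dF; apply: inD => //; rewrite subrr normr0 divr_gt0.
  + exact: is_derive_scalel.
- move=> t t01; apply: norm_diffBB_le => i.
  exact: xhc.
Qed.

Lemma taylor1_le : Ck 2 F D -> exists2 r, 0 < r & forall h, `|h| < r ->
  forall c, 0 <= c ->
  (forall t, 0 <= t <= 1 -> forall i,
     `|'d F (x0 + t *: h) (ebasis i) - 'd F x0 (ebasis i)| <= c) ->
  `|taylor1 x0 h| <= d%:R * (`|h| * c).
Proof.
move=> [dF _].
have [r r0 rD] := (near_radius _ _).1 (open_nbhs_nbhs (conj oD Dx0)).
exists r => // h hr c c0 hc.
have inD t : 0 <= t <= 1 -> D (x0 + t *: h).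
  move=> /andP[t0 t1]; apply: rD; rewrite addrAC subrr add0r normrZ ger0_norm//.
  exact: le_lt_trans (ler_piMl (normr_ge0 h) t1) hr.
pose g t := F (x0 + t *: h) - t *: 'd F x0 h.
have -> : taylor1 x0 h = g 1 - g 0.
  have alg (a1 a2 u : 'rV[R]_d) : a1 - a2 - u = a1 - u - (a2 - 0).
    by apply/rowP => i; rewrite !mxE; ring.
  by rewrite /g /taylor1 !scale1r !scale0r !addr0; exact: alg.
apply: (@mean_value_le _ (fun t => 'd F (x0 + t *: h) h - 'd F x0 h)).
- by rewrite !mulr_ge0.
- move=> t t01; apply: is_deriveB.
  + by apply: is_derive_line; apply: dF; exact: inD.
  + exact: is_derive_scalel.
- by move=> t t01; apply: norm_diffB_le => i; exact: hc.
Qed.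

End Calculus.

(** * Second order remainders at neighbouring base points *)

Section Taylor.
Context {R : realType} {d : nat}.
Variables (F : 'rV[R]_d -> 'rV[R]_d) (D : set 'rV[R]_d) (x0 : 'rV[R]_d).
Hypotheses (oD : open D) (Dx0 : D x0) (cF : Ck 2 F D).
Implicit Types (x y h : 'rV[R]_d).

(** By strict differentiability of [z |-> 'd F z (ebasis i)] at [x0], its increments along [t *: h]
    from [x] and from [x0] are both within [e * |h|] of the same linear term. That term cancels in
    the second difference. *)
Lemma taylor1_close (eta : R) : 0 < eta ->
  exists2 r, 0 < r & forall x h, `|x - x0| < r -> `|h| < r ->
    `|taylor1 F x h - taylor1 F x0 h| <= eta * `|h| ^+ 2.
Proof.
(* The [2] pays for the two comparisons with the common linear term, [d.+1] for the sum over the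
   basis. *)
move=> eta0; pose e := eta / (d.+1%:R * 2).
have e0 : 0 < e by rewrite divr_gt0// mulr_gt0.
have [r r0 rF] := @common_radius R d
  (fun i r => forall x y, `|x - x0| < r -> `|y - x0| < r ->
    `|'d F y (ebasis i) - 'd F x (ebasis i) -
      'd (fun z => 'd F z (ebasis i)) x0 (y - x)| <= e * `|y - x|)
  (fun i => strict_diff oD Dx0 (cF.2 (ebasis i)) e0)
  (fun i r s sr P x y xs ys => P x y (lt_le_trans xs sr) (lt_le_trans ys sr)).
have [s s0 sF] := taylor1_near oD Dx0 cF.
exists (Num.min (r / 2) s) => [|x h]; first by rewrite lt_min divr_gt0//=.
rewrite !lt_min => /andP[xr xs] /andP[hr hs].
have c0 : 0 <= 2 * e * `|h| by rewrite !mulr_ge0// ltW.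
apply: le_trans (sF x h xs hs _ c0 _) _; last first.
  rewrite /e [leLHS](_ : _ = (eta * `|h| ^+ 2) * (d%:R / d.+1%:R)); last first.
    have : d.+1%:R != 0 :> R by rewrite pnatr_eq0.
    by move: (d.+1%:R) (d%:R) `|h| => S N H S0; field.
  rewrite ler_piMr ?mulr_ge0 ?(ltW eta0) ?sqr_ge0//.
  by rewrite ler_pdivrMr// mul1r ler_nat.
move=> t t01 i; have /andP[t0 t1] := t01.
have th : `|t *: h| <= `|h| by rewrite normrZ ger0_norm// ler_piMl.
have key y : `|y - x0| < r / 2 ->
    `|'d F (y + t *: h) (ebasis i) - 'd F y (ebasis i) -
      'd (fun z => 'd F z (ebasis i)) x0 (t *: h)| <= e * `|h|.
  move=> yr; have yth : `|y + t *: h - x0| < r.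
    by rewrite addrAC (le_lt_trans (ler_normD _ _))//; lra.
  have E : y + t *: h - y = t *: h by rewrite addrAC subrr add0r.
  have gen w : w = t *: h -> `|'d F (y + t *: h) (ebasis i) - 'd F y (ebasis i) -
      'd (fun z => 'd F z (ebasis i)) x0 w| <= e * `|w| ->
      `|'d F (y + t *: h) (ebasis i) - 'd F y (ebasis i) -
      'd (fun z => 'd F z (ebasis i)) x0 (t *: h)| <= e * `|t *: h| by move=> ->.
  have yr' : `|y - x0| < r by lra.
  have := gen _ E (rF i y _ yr' yth) => /le_trans; apply.
  by rewrite ler_wpM2l// ltW.
have alg (u1 u2 u3 u4 w : 'rV[R]_d) (c : R) : `|u1 - u3 - w| <= c ->
    `|u2 - u4 - w| <= c -> `|u1 - u2 - (u3 - u4)| <= 2 * c.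
  move=> c1 c2; have -> : u1 - u2 - (u3 - u4) = (u1 - u3 - w) - (u2 - u4 - w).
    by apply/rowP => j; rewrite !mxE; ring.
  by apply: (le_trans (ler_normB _ _)); lra.
rewrite -mulrA; apply: alg (key _ xr) (key _ _).
by rewrite subrr normr0 divr_gt0.
Qed.

Lemma taylor1_bound : exists2 r, 0 < r & exists2 K, 0 < K &
  forall h, `|h| < r -> `|taylor1 F x0 h| <= K * `|h| ^+ 2.
Proof.
(* Using [r^-1] as the Lipschitz constant ties it to the radius: decreasing [r] weakens the
   statement in both places, as [common_radius] requires. *)
have lip i : exists2 r, 0 < r & forall h, `|h| < r ->
    `|'d F (x0 + h) (ebasis i) - 'd F x0 (ebasis i)| <= r^-1 * `|h|.
  have [r r0 [L L0 rL]] := strict_diff_lipschitz oD Dx0 (cF.2 (ebasis i)).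
  exists (Num.min r L^-1) => [|h]; first by rewrite lt_min r0 invr_gt0.
  rewrite lt_min => /andP[hr hL].
  have E : x0 + h - x0 = h by rewrite addrAC subrr add0r.
  have xr : `|x0 - x0| < r by rewrite subrr normr0.
  have hr' : `|x0 + h - x0| < r by rewrite E.
  apply: le_trans (rL _ _ xr hr') _; rewrite E ler_wpM2r//.
  by rewrite -[L in leLHS]invrK lef_pV2 ?posrE ?lt_min ?invr_gt0 ?r0//= ge_min lexx orbT.
have [i r s sr rh h hs|r r0 rF] := common_radius lip.
  apply: le_trans (rh h (lt_le_trans hs sr)) _; rewrite ler_wpM2r//.
  have s0 : 0 < s := le_lt_trans (normr_ge0 h) hs.
  by rewrite lef_pV2// posrE// (lt_le_trans s0).
have [s s0 sF] := taylor1_le oD Dx0 cF.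
exists (Num.min r s); first by rewrite lt_min r0.
exists (d.+1%:R * r^-1) => [|h]; first by rewrite mulr_gt0 ?invr_gt0.
rewrite lt_min => /andP[hr hs].
have c0 : 0 <= r^-1 * `|h| by rewrite mulr_ge0// invr_ge0 ltW.
apply: le_trans (sF h hs _ c0 _) _.
  move=> t /andP[t0 t1] i.
  have th : `|t *: h| <= `|h| by rewrite normrZ ger0_norm// ler_piMl.
  apply: le_trans (rF i _ (le_lt_trans th hr)) _.
  by rewrite ler_wpM2l// invr_ge0 ltW.
rewrite [leLHS](_ : _ = d%:R * (r^-1 * `|h| ^+ 2)); last by ring.
rewrite -mulrA ler_wpM2r ?ler_nat//.
by rewrite mulr_ge0 ?sqr_ge0// invr_ge0 ltW.
Qed.
End Taylor.

(** * Normal vectors and charts *)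

Section ProxNormal.
Context {R : realType} {d : nat}.
Variable M : set 'rV[R]_d.
Implicit Types (u v w x y z xi h : 'rV[R]_d) (a b e t : R).

Lemma is_derive_coord (f : R -> 'rV[R]_d) t df i :
  is_derive t 1 f df -> is_derive t 1 (fun s => f s ord0 i) (df ord0 i).
Proof.
move=> [ft <-]; split; first by move/derivable_mxP : ft.
by rewrite derive_mx// mxE.
Qed.

Lemma is_derive_dot (f g : R -> 'rV[R]_d) t df dg :
  is_derive t 1 f df -> is_derive t 1 g dg ->
  is_derive t 1 (fun s => dot (f s) (g s)) (dot df (g t) + dot (f t) dg).
Proof.
move=> fdf gdg.
have -> : (fun s => dot (f s) (g s)) = \sum_(i < d) (fun s => f s ord0 i * g s ord0 i).
  by apply/funext => s; rewrite fct_sumE.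
rewrite /dot -big_split; apply: is_derive_sum => i.
have fi := is_derive_coord i fdf; have gi := is_derive_coord i gdg.
have := is_deriveM fi gi; rewrite /GRing.scale /= addrC [g t _ _ * _]mulrC.
exact.
Qed.

(** Along a curve in [M] through [xi], the function [|gam - xi|^2 - 2 <v, gam - xi>] is nonnegative
    and vanishes at [0], so its derivative there, [- 2 <v, gam' 0>], is zero. *)
Lemma prox_normal xi v : prox M xi v -> Defs.normal_space M xi v.
Proof.
move=> pv _ [e [gam [e0 [dgam _] Mgam gam0 <-]]].
pose f t := dot (gam t - xi) (gam t - xi) - 2 * dot v (gam t - xi).
have gamd t : t \in `](- e), e[%R -> is_derive t 1 gam (derive1 gam t).
  move=> te; rewrite derive1E; apply/derivableP/derivable1_diffP/dgam.
  by rewrite /= in_itv /= in te *.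
have fd t : t \in `](- e), e[%R -> is_derive t 1 f
    (2 * dot (derive1 gam t) (gam t - xi) - 2 * dot v (derive1 gam t)).
  move=> te; have gt := gamd t te.
  have gxi : is_derive t 1 (fun s => gam s - xi) (derive1 gam t).
    have := is_deriveB gt (is_derive_cst xi t 1); rewrite subr0; exact.
  have d1 := is_derive_dot gxi gxi.
  have d2 := is_derive_dot (is_derive_cst v t 1) gxi.
  rewrite dot0l add0r in d2.
  apply: is_derive_eq; rewrite /GRing.scale /=.
  by rewrite (dotC (gam t - xi)); ring.
have e00 : 0 \in `](- e), e[%R by rewrite in_itv /= oppr_lt0 e0.
have f0 : f 0 = 0 by rewrite /f gam0 subrr !dot0r mulr0 subrr.
have : is_derive (0 : R) 1 f 0.
  apply: (@derive1_at_min R f (- e) e 0) => //.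
  - by rewrite ge0_cp ?ltW.
  - by move=> t te; have [] := fd t te.
  - move=> t te; rewrite f0 /f subr_ge0; apply: pv; apply: Mgam.
    by rewrite /= in_itv /= in te *.
have fdrv := fd _ e00.
move=> [_]; have [_ ->] := fdrv.
rewrite gam0 subrr dot0r mulr0 sub0r => /eqP.
by rewrite oppr_eq0 mulf_eq0 pnatr_eq0 /= => /eqP.
Qed.

End ProxNormal.

(** * Local closedness, tangent vectors and the chord inequality in a chart *)

Section Chart.
Context {R : realType} {d : nat}.
Variables (M : set 'rV[R]_d) (m : nat) (U V : set 'rV[R]_d).
Variables (Psi Phi : 'rV[R]_d -> 'rV[R]_d).
Hypotheses (oU : open U) (oV : open V) (PP : Ck_diffeomorphism 2 V U Psi Phi).
Implicit Types (u v w x y z a xi h : 'rV[R]_d) (e t : R).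

Definition flat y := forall i : 'I_d, (m <= i)%N -> y ord0 i = 0.

Hypothesis MPsi : forall y, V y -> (M (Psi y) <-> flat y).

Lemma flatB y z : flat y -> flat z -> flat (y - z).
Proof. by move=> fy fz i mi; rewrite !mxE fy// fz// subrr. Qed.

Lemma flatD_scale y z t : flat y -> flat z -> flat (y + t *: z).
Proof. by move=> fy fz i mi; rewrite !mxE fy// fz// mulr0 addr0. Qed.

Lemma chart_inv x : U x -> V (Phi x) /\ Psi (Phi x) = x.
Proof.
by move=> Ux; split; [exact: diffeo_inv_fun PP _ Ux|exact: diffeo_invK PP _ (mem_set Ux)].
Qed.

Lemma chart_flat x : U x -> M x -> flat (Phi x).
Proof. by move=> /chart_inv[VPx PPx] Mx; apply/(MPsi VPx); rewrite PPx. Qed.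

Lemma Phi_continuous x : U x -> {for x, continuous Phi}.
Proof. by move=> Ux; apply/differentiable_continuous/(diffeo_inv_Ck PP).1. Qed.

(** The equations of [M] in the chart are closed conditions: a nonzero last coordinate of [Phi x]
    would stay nonzero near [x], where there are points of [M]. *)
Lemma closure_chart x : closure M x -> U x -> M x.
Proof.
move=> Mx Ux; have [VPx <-] := chart_inv Ux.
apply/(MPsi VPx) => i mi; apply/eqP; apply: contrapT => /negP Pxi.
have nU : nbhs x U by exact: open_nbhs_nbhs.
have nP : \forall y \near x, 0 < `|Phi y ord0 i|.
  have c : `|Phi y ord0 i| @[y --> x] --> `|Phi x ord0 i|.
    have cP : Phi y @[y --> x] --> Phi x by exact: Phi_continuous.
    have ci : Phi y ord0 i @[y --> x] --> Phi x ord0 i by exact: (cvg_coord cP).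
    exact: (cvg_norm ci).
  by apply: (cvgr_gt _ c); rewrite normr_gt0.
have [y [My [Uy]]] := Mx _ (filterI nU nP).
by rewrite /= (chart_flat Uy My mi) normr0 ltxx.
Qed.

(** The image under [Psi] of the straight line [a + t *: h] is a curve in [M] with this velocity. *)
Lemma tangent_chart a h : V a -> flat a -> flat h ->
  tangent_space M (Psi a) ('d Psi a h).
Proof.
move=> Va fa fh; pose gam t := Psi (a + t *: h).
have nV : \forall t \near (0 : R), V (a + t *: h).
  exact: (@cvg_line R d a h _ (open_nbhs_nbhs (conj oV Va))).
have [e e0 eV] := (near_radius _ _).1 nV.
have inV t : `]- e, e[%classic t -> V (a + t *: h).
  by rewrite /= in_itv /= => te; apply: eV; rewrite subr0 ltr_norml.
have gamd t : `]- e, e[%classic t -> is_derive t 1 gam ('d Psi (a + t *: h) h).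
  by move=> te; apply/is_derive_line/(diffeo_Ck PP).1/inV.
have gam0 : gam 0 = Psi a by rewrite /gam scale0r addr0.
exists e, gam; split=> //.
- split=> [t te|v t te]; first by apply/derivable1_diffP; have [] := gamd t te.
  have nte : \forall s \near t, `]- e, e[%classic s.
    by apply: open_nbhs_nbhs; split=> //; exact: interval_open.
  have dgam s : `]- e, e[%classic s -> 'd gam s v = v *: 'd Psi (a + s *: h) h.
    move=> se; have [ex val] := gamd s se.
    by rewrite deriv1E// derive1E val.
  have c : v *: 'd Psi (a + s *: h) h @[s --> t] --> v *: 'd Psi (a + t *: h) h.
    apply: cvgZl_tmp.
    have : {for a + t *: h, continuous (fun y => 'd Psi y h)}.
      by apply: differentiable_continuous; exact: ((diffeo_Ck PP).2 h).1 (inV _ te).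
    apply: cvg_comp; apply: cvgD; [exact: cvg_cst | exact: cvgZr_tmp].
  rewrite /prop_for /continuous_at dgam//.
  apply: cvg_trans c; apply: near_eq_cvg.
  by near=> s; apply/esym/dgam; near: s.
- by move=> t te; apply/(MPsi (inV _ te)); exact: flatD_scale.
- rewrite derive1E; have [|_ ->] := gamd 0; last by rewrite scale0r addr0.
  by rewrite /= in_itv /= oppr_lt0 e0.
Unshelve. all: by end_near. Qed.

Let n : R := d%:R.

Let dot_le u v : dot u v <= n * (`|u| * `|v|).
Proof. exact: le_trans (ler_norm _) (dot_le_norm u v). Qed.

(* [w], [w0]: chords of [M] spanned by the coordinate increment [h] at a nearby
   point and at the base point; [D], [D0]: their second order parts. *)
Let chord_ineq (e eta K L : R) v v1 w w0 D D0 h :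
  0 < e -> 0 < eta <= 1 -> 0 < K -> 0 < L ->
  eta * (4 * n * L * (1 + L) + 2 * n * (`|v| + 1) * L ^+ 2 + 2 * n * K * L ^+ 2) <=
    e / (2 * (1 + e)) ->
  dot v1 w = dot v1 D -> dot v w0 = dot v D0 ->
  2 * ((1 + e) * dot v w0) <= dot w0 w0 ->
  `|w0 - w| <= 2 * eta * `|h| -> `|h| <= L * `|w| ->
  `|D - D0| <= eta * `|h| ^+ 2 -> `|D0| <= K * `|h| ^+ 2 ->
  `|v1 - v| <= eta ->
  2 * dot v1 w <= (1 - e / (2 * (1 + e))) * dot w w.
Proof.
move=> e0 /andP[eta0 eta1] K0 L0 etaQ v1D vD0 proxv w0w hw DD0 D0h v1v.
have n0 : 0 <= n by rewrite ler0n.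
(* The first two terms are errors bounded by [eta] times a multiple of [|h|^2]; the last is governed
   by the hypothesis at the base point. *)
have split_v1 : dot v1 D = dot v1 (D - D0) + dot (v1 - v) D0 + dot v D0.
  by rewrite !dotE; ring.
have split_w0 : dot w0 w0 = dot w w + dot (w0 - w) (w0 + w).
  by rewrite !dotE (dotC w w0); ring.
have v1_le : `|v1| <= `|v| + 1.
  by rewrite -(subrK v v1) (le_trans (ler_normD _ _))// addrC lerD2l (le_trans v1v).
have W0 := normr_ge0 w; have H0 := normr_ge0 h.
have hsq : `|h| ^+ 2 <= L ^+ 2 * `|w| ^+ 2.
  by rewrite -exprMn ler_pXn2r// nnegrE ?mulr_ge0// ltW.
have b1 : dot v1 (D - D0) <= n * (`|v| + 1) * eta * (L ^+ 2 * `|w| ^+ 2).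
  apply: le_trans (dot_le _ _) _; rewrite -[leRHS]mulrA -[leRHS]mulrA ler_wpM2l//.
  apply: ler_pM => //; apply: le_trans DD0 _.
  exact: (ler_wpM2l (ltW eta0) hsq).
have b2 : dot (v1 - v) D0 <= n * eta * K * (L ^+ 2 * `|w| ^+ 2).
  apply: le_trans (dot_le _ _) _; rewrite -[leRHS]mulrA -[leRHS]mulrA ler_wpM2l//.
  apply: ler_pM => //; apply: le_trans D0h _.
  exact: (ler_wpM2l (ltW K0) hsq).
have w0w' : `|w0 - w| <= 2 * eta * (L * `|w|).
  by apply: le_trans w0w _; rewrite ler_wpM2l// mulr_ge0// ltW.
have w0_le : `|w0 + w| <= 2 * (1 + L) * `|w|.
  have -> : w0 + w = (w0 - w) + w *+ 2 by rewrite mulr2n addrA subrK.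
  rewrite (le_trans (ler_normD _ _))// normrMn.
  have : 2 * eta * (L * `|w|) <= 2 * (L * `|w|).
    by rewrite ler_wpM2r ?mulr_ge0 ?(ltW L0)//; lra.
  by rewrite -mulr_natl; lra.
have b4 : dot (w0 - w) (w0 + w) <= 4 * n * eta * L * (1 + L) * `|w| ^+ 2.
  apply: le_trans (dot_le _ _) _.
  apply: (@le_trans _ _ (n * ((2 * eta * (L * `|w|)) * (2 * (1 + L) * `|w|)))).
    by rewrite ler_wpM2l// ler_pM.
  by rewrite le_eqVlt; apply/orP; left; apply/eqP; ring.
have WD : `|w| ^+ 2 <= dot w w := sqr_norm_le_dot w.
have e1 : 0 < 1 + e by rewrite addr_gt0.
have b3 : 2 * dot v w0 <= dot w w / (1 + e) + 4 * n * eta * L * (1 + L) * `|w| ^+ 2.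
  have extra0 : 0 <= 4 * n * eta * L * (1 + L) * `|w| ^+ 2.
    by rewrite !mulr_ge0 ?sqr_ge0 ?addr_ge0 ?(ltW L0) ?(ltW eta0).
  have : 2 * dot v w0 <= (dot w w + 4 * n * eta * L * (1 + L) * `|w| ^+ 2) / (1 + e).
    by rewrite ler_pdivlMr//; lra.
  move=> /le_trans; apply; rewrite mulrDl lerD2l ler_pdivrMr//.
  by rewrite ler_peMr//; lra.
have total : 2 * dot v1 w <= dot w w / (1 + e) +
    eta * (4 * n * L * (1 + L) + 2 * n * (`|v| + 1) * L ^+ 2 + 2 * n * K * L ^+ 2) *
    `|w| ^+ 2.
  rewrite v1D split_v1 -vD0.
  by move: b1 b2 b3; move: (L ^+ 2) (`|w| ^+ 2) => *; lra.
apply: le_trans total _.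
have : eta * (4 * n * L * (1 + L) + 2 * n * (`|v| + 1) * L ^+ 2 + 2 * n * K * L ^+ 2) *
    `|w| ^+ 2 <= e / (2 * (1 + e)) * dot w w.
  apply: ler_pM => //.
  by rewrite mulr_ge0 ?(ltW eta0)// !addr_ge0// !mulr_ge0 ?addr_ge0 ?sqr_ge0 ?(ltW L0) ?(ltW K0).
(* With [c = e / (2 * (1 + e))], the gap [1 - 1 / (1 + e)] is [2 * c]: half of it absorbs the
   errors, half remains in the conclusion. *)
have -> : dot w w / (1 + e) = (1 - 2 * (e / (2 * (1 + e)))) * dot w w.
  by field; rewrite gt_eqF.
by move: (dot w w) (e / _) => X Y; lra.
Qed.

(** Normality of [v1] kills the first order part of the chord, leaving the remainder at [x1]. This
    is compared with the remainder at [xi] for the same increment [h], where [prox] at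
    [(1 + e) *: v] leaves a gap. *)
Lemma chord_normal_ineq xi v e : U xi -> M xi -> 0 < e -> prox M xi ((1 + e) *: v) ->
  exists2 c, 0 < c & exists2 r, 0 < r & forall x1 x2 v1, M x1 -> M x2 ->
    `|x1 - xi| < r -> `|x2 - xi| < r -> `|v1 - v| < r -> Defs.normal_space M x1 v1 ->
    2 * dot v1 (x2 - x1) <= (1 - c) * dot (x2 - x1) (x2 - x1).
Proof.
move=> Uxi Mxi e0 pv; have [Vy0 Psiy0] := chart_inv Uxi.
have fy0 := chart_flat Uxi Mxi.
have [dPsi _] := diffeo_Ck PP.
have CkPsi : Ck 1 Psi V.
  split=> // u x Vx; apply: differentiable_continuous.
  exact: ((diffeo_Ck PP).2 u).1.
have CkPhi : Ck 1 Phi U.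
  split=> [|u x Ux]; first exact: (diffeo_inv_Ck PP).1.
  apply: differentiable_continuous.
  exact: ((diffeo_inv_Ck PP).2 u).1.
have [r1 r10 [L L0 PhiL]] := strict_diff_lipschitz oU Uxi CkPhi.
have [r2 r20 [K K0 PsiK]] := taylor1_bound oV Vy0 (diffeo_Ck PP).
(* The three terms come from replacing [|w0|^2] by [|w|^2], [D] by [D0] and [v1] by [v]; [L]
   converts [|h|] into the length of the chord. *)
pose Q := 4 * n * L * (1 + L) + 2 * n * (`|v| + 1) * L ^+ 2 + 2 * n * K * L ^+ 2.
have Q0 : 0 <= Q.
  by rewrite !addr_ge0// !mulr_ge0 ?addr_ge0 ?sqr_ge0 ?ler0n ?(ltW L0) ?(ltW K0).
pose c := e / (2 * (1 + e)).
have c0 : 0 < c by rewrite divr_gt0// mulr_gt0// addr_gt0.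
pose eta := Num.min 1 (c / (Q + 1)).
have Q1 : 0 < Q + 1 by lra.
have eta0 : 0 < eta by rewrite lt_min ltr01 divr_gt0.
have eta1 : eta <= 1 by rewrite ge_min lexx.
have etaQ : eta * Q <= c.
  have : eta <= c / (Q + 1) by rewrite ge_min lexx orbT.
  rewrite ler_pdivlMr// mulrDr mulr1 => etaQ; lra.
clearbody eta.
have [r3 r30 Psi3] := taylor1_close oV Vy0 (diffeo_Ck PP) eta0.
have [r4 r40 Psi4] := strict_diff oV Vy0 CkPsi eta0.
have [r5 r50 V5] := (near_radius _ _).1 (open_nbhs_nbhs (conj oV Vy0)).
pose s := Num.min (Num.min r2 r3) (Num.min r4 r5).
have s0 : 0 < s by rewrite !lt_min r20 r30 r40.
have nPhi : \forall x \near xi, `|Phi xi - Phi x| < s / 2.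
  have cP : Phi y @[y --> xi] --> Phi xi by exact: Phi_continuous.
  by move/cvgrPdist_lt : cP; apply; rewrite divr_gt0.
have [r6 r60 Phi6] := (near_radius _ _).1 nPhi.
have [r7 r70 U7] := (near_radius _ _).1 (open_nbhs_nbhs (conj oU Uxi)).
exists c => //; exists (Num.min (Num.min r1 r6) (Num.min r7 eta)).
  by rewrite !lt_min r10 r60 r70 eta0.
move=> x1 x2 v1 Mx1 Mx2; rewrite !lt_min => /andP[/andP[x1r1 x1r6] /andP[x1r7 _]].
move=> /andP[/andP[x2r1 x2r6] /andP[x2r7 _]] /andP[_ /andP[_ v1v]] nv1.
have Ux1 := U7 _ x1r7; have Ux2 := U7 _ x2r7.
have [Va Psia] := chart_inv Ux1; have [Vb Psib] := chart_inv Ux2.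
have fa := chart_flat Ux1 Mx1; have fb := chart_flat Ux2 Mx2.
pose h := Phi x2 - Phi x1.
have fh : flat h by exact: flatB.
have ahE : Phi x1 + h = Phi x2 by rewrite subrKC.
have as_ : `|Phi x1 - Phi xi| < s.
  by rewrite distrC (lt_trans (Phi6 _ x1r6))// ltr_pdivrMr// ltr_pMr// ltr1n.
have bs_ : `|Phi x2 - Phi xi| < s.
  by rewrite distrC (lt_trans (Phi6 _ x2r6))// ltr_pdivrMr// ltr_pMr// ltr1n.
have hs : `|h| < s.
  rewrite /h -(subrKA (Phi xi)) (le_lt_trans (ler_normD _ _))//.
  by have := Phi6 _ x1r6; have := Phi6 _ x2r6; rewrite (distrC _ (Phi x2)); lra.
have y0h : `|Phi xi + h - Phi xi| < s by rewrite addrAC subrr add0r.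
have y0y0 : `|Phi xi - Phi xi| < s by rewrite subrr normr0.
move: (as_) (bs_) (hs) (y0h) (y0y0); rewrite {1 2 3 4 5}/s !lt_min.
move=> /andP[/andP[_ a3] /andP[a4 _]] /andP[_ /andP[b4 _]].
move=> /andP[/andP[h2 h3] _] /andP[_ /andP[y4 y5]] /andP[_ /andP[z4 _]].
have Vy0h := V5 _ y5.
have fy0h : flat (Phi xi + h) by move=> i mi; rewrite mxE fy0// fh// addr0.
(* The chord of [M] at [xi] with the coordinate increment of the chord from [x1] to [x2]. *)
pose w0 := Psi (Phi xi + h) - xi.
have tan1 := tangent_chart Va fa fh; rewrite Psia in tan1.
have tan0 := tangent_chart Vy0 fy0 fh; rewrite Psiy0 in tan0.
apply: (@chord_ineq e eta K L v v1 (x2 - x1) w0 (taylor1 Psi (Phi x1) h)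
  (taylor1 Psi (Phi xi) h) h) => //.
- by rewrite eta0.
- by rewrite /taylor1 ahE Psia Psib [RHS]dotBr (nv1 _ tan1) subr0.
- rewrite /taylor1 Psiy0 [RHS]dotBr.
  have /eqP := prox_normal pv tan0.
  by rewrite dotZl mulf_eq0 gt_eqF ?addr_gt0//= => /eqP ->; rewrite subr0.
- rewrite -dotZl; apply: pv; exact/(MPsi Vy0h).
- have := Psi4 _ _ a4 b4; have := Psi4 _ _ z4 y4.
  rewrite Psiy0 Psia Psib (_ : Phi xi + h - Phi xi = h); last by rewrite addrAC subrr add0r.
  rewrite -/h -/w0; move: ('d Psi (Phi xi) h) => k c1 c2.
  have alg (p q : 'rV[R]_d) : p - q = (p - k) - (q - k).
    by rewrite opprB addrA subrK.
  rewrite (alg w0).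
  by rewrite (le_trans (ler_normB _ _))//; lra.
- exact: PhiL.
- exact: Psi3.
- exact: PsiK.
- exact: ltW.
Qed.

End Chart.

(** * Stability of closest points *)

Section Stability.
Context {R : realType} {d m : nat}.
Variable M : set 'rV[R]_d.
Hypothesis hM : is_submanifold 2 m M.
Implicit Types (u v w x y z xi h : 'rV[R]_d) (a b e t : R).

Let locally_closed xi : M xi ->
  exists2 r, 0 < r & forall x, closure M x -> `|x - xi| < r -> M x.
Proof.
move=> /hM.2[U [V [Psi [Phi [oU oV Uxi PP MPsi]]]]].
have [r r0 rU] := (near_radius _ _).1 (open_nbhs_nbhs (conj oU Uxi)).
exists r => // x Mx xr; exact: (closure_chart oU PP MPsi Mx (rU _ xr)).
Qed.

(* Any closest point of the closure to a point near [xi + v] is near [xi], where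
   the chord inequality makes it unique. *)
Lemma prox_stable xi v e : M xi -> 0 < e -> prox M xi ((1 + e) *: v) ->
  exists2 r, 0 < r & (forall y, `|y - (xi + v)| < r -> unpp M y) /\
    forall x1 v1, M x1 -> Defs.normal_space M x1 v1 -> `|x1 - xi| < r ->
      `|v1 - v| < r -> prox M x1 v1.
Proof.
move=> Mxi e0 pv.
have [U [V [Psi [Phi [oU oV Uxi PP MPsi]]]]] := hM.2 _ Mxi.
have [c c0 [r1 r10 chord]] := chord_normal_ineq oU oV PP MPsi Uxi Mxi e0 pv.
have [r2 r20 lc] := locally_closed Mxi.
have uniq z : closure M z -> z <> xi ->
    dot (xi + v - xi) (xi + v - xi) < dot (xi + v - z) (xi + v - z).
  move=> Mz /eqP zxi; have := prox_closure pv Mz.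
  have -> : xi + v - z = v - (z - xi) by rewrite opprB addrA (addrC v).
  have -> : xi + v - xi = v by rewrite addrAC subrr add0r.
  have : z - xi != 0 by rewrite subr_eq0.
  move=> /dot_gt0; move: (z - xi) => k; rewrite !dotE (dotC k v).
  by move: (dot k k) (dot v k) (dot v v) => q p s *; nra.
(* The half leaves room for [y - z - v], a difference of two vectors of norm less than [s]. *)
pose s := Num.min r1 r2 / 2.
have s0 : 0 < s by rewrite divr_gt0// lt_min r10.
have [r3 r30 far] := (near_radius _ _).1 (far_from_nearest uniq s0).
pose r := Num.min r3 s.
have r0 : 0 < r by rewrite lt_min r30.
have s1 : 2 * s <= r1 by rewrite mulrC divfK ?pnatr_eq0// ge_min lexx.
have s2 : 2 * s <= r2 by rewrite mulrC divfK ?pnatr_eq0// ge_min lexx orbT.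
(* [far] forces [z] close to [xi], and there local closedness puts it into [M]. *)
have closest y z : `|y - (xi + v)| < r -> closure M z ->
    (forall x, M x -> dot (y - z) (y - z) <= dot (y - x) (y - x)) ->
    [/\ nearest M y z, `|z - xi| < s & `|y - z - v| < r1].
  rewrite lt_min => /andP[y3 ys] Mz zmin.
  have zs : `|z - xi| < s.
    rewrite ltNge; apply/negP => /(far y y3 z Mz).
    by rewrite ltNge => /negP; apply; exact: zmin.
  have Mz' : M z by apply: lc Mz _; lra.
  split=> //; first exact/nearestP.
  have -> : y - z - v = (y - (xi + v)) - (z - xi).
    by apply/rowP => i; rewrite !mxE; ring.
  by apply: (le_lt_trans (ler_normB _ _)); lra.
have exists_near y : `|y - (xi + v)| < r ->
    exists z, [/\ nearest M y z, `|z - xi| < s & `|y - z - v| < r1].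
  move=> yr; have [z Mz zmin] := exists_closest y hM.1.
  by exists z; apply: closest => // x Mx; apply: zmin; exact: subset_closure.
exists (r / 2); first by rewrite divr_gt0.
split=> [y yr|x1 v1 Mx1 nv1 x1r v1r].
  have yr' : `|y - (xi + v)| < r by lra.
  have [z [nz zs zv]] := exists_near y yr'; exists z; split=> // z' nz'.
  have [_ zs' _] : [/\ nearest M y z', `|z' - xi| < s & `|y - z' - v| < r1].
    apply: closest => //; first by apply: subset_closure; exact: nz'.1.
    by move/nearestP : nz' => [].
  have [Mz pz] := (nearest_prox _ _ _).1 nz.
  have zr1 : `|z - xi| < r1 by lra.
  have zr1' : `|z' - xi| < r1 by lra.
  (* With [a = y - z], normal at [z], and [b = z' - z], the chord inequality gives
     [|a - b|^2 >= |a|^2 + c * |b|^2], so a second closest point must equal [z]. *)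
  have := chord _ _ _ Mz nz'.1 zr1 zr1' zv (prox_normal pz).
  have [_ /(_ _ Mz)] := (nearestP _ _ _).1 nz'.
  have -> : y - z' = (y - z) - (z' - z) by rewrite opprB addrA subrK.
  move=> le1 le2; apply/eqP; rewrite eq_sym -subr_eq0; apply/negPn/negP => /dot_gt0.
  move: le1 le2; move: (y - z) (z' - z) => a b; rewrite !dotE (dotC b a).
  by move: (dot a a) (dot a b) (dot b b) => p q s' *; nra.
have yr : `|x1 + v1 - (xi + v)| < r.
  rewrite (_ : _ - _ = (x1 - xi) + (v1 - v)); last by rewrite addrACA opprD.
  by apply: (le_lt_trans (ler_normD _ _)); lra.
have [z [nz zs zv]] := exists_near _ yr.
have r_s : r <= s by rewrite ge_min lexx orbT.
(* A closest point [z] exists near [xi]; the chord inequality shows that [x1] is no farther from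
   [x1 + v1], so [x1] is closest as well. *)
have le1 : dot v1 v1 <= dot (x1 + v1 - z) (x1 + v1 - z).
  rewrite dot_sub_le.
  have x1r1 : `|x1 - xi| < r1 by lra.
  have zr1 : `|z - xi| < r1 by lra.
  have v1r1 : `|v1 - v| < r1 by lra.
  have := chord _ _ _ Mx1 nz.1 x1r1 zr1 v1r1 nv1.
  have := dot_ge0 (z - x1); move: (dot (z - x1) _) => q *; nra.
apply/proxP => x Mx; apply: le_trans le1 _.
by move/nearestP : nz => [_]; apply.
Qed.

Lemma prox_calE xi v e : M xi -> 0 < e -> prox M xi ((1 + e) *: v) -> calE M (xi + v).
Proof.
move=> Mxi e0 pv; have [r r0 [ru _]] := prox_stable Mxi e0 pv.
exact: ((near_radius _ _).2 (ex_intro2 _ _ r r0 ru)).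
Qed.

Lemma prox_metric_proj xi v e : M xi -> 0 < e -> prox M xi ((1 + e) *: v) ->
  metric_proj M (xi + v) = xi.
Proof.
move=> Mxi e0 pv; apply: metric_proj_eq.
  exact: interior_subset (prox_calE Mxi e0 pv).
apply/nearest_prox; rewrite addrAC subrr add0r; split=> //.
have -> : v = (1 + e)^-1 *: ((1 + e) *: v).
  by rewrite scalerA mulVf ?scale1r// gt_eqF// addr_gt0.
apply: prox_scale => //.
have e1 : 0 < 1 + e by rewrite addr_gt0.
by rewrite invr_ge0 ltW//= invf_le1//; lra.
Qed.

Lemma normal_scale xi v t : Defs.normal_space M xi v -> Defs.normal_space M xi (t *: v).
Proof. by move=> nv u /nv vu; rewrite dotZl vu mulr0. Qed.

Lemma normalD xi v w : Defs.normal_space M xi v -> Defs.normal_space M xi w ->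
  Defs.normal_space M xi (v + w).
Proof. by move=> nv nw u Tu; rewrite dotDl nv// nw// addr0. Qed.

Lemma normal0 xi : Defs.normal_space M xi 0.
Proof. by move=> u _; rewrite dot0l. Qed.

(** Stability around the zero vector, for which [prox] is trivial, covers all sufficiently short
    normal vectors. *)
Lemma normal_prox_small xi v : M xi -> Defs.normal_space M xi v ->
  exists2 e, 0 < e & prox M xi (e *: v).
Proof.
move=> Mxi nv.
have p0 : prox M xi ((1 + 1) *: 0) by rewrite scaler0; exact: prox0.
have [r r0 [_ rp]] := prox_stable Mxi ltr01 p0.
exists (r / (`|v| + 1)); first by rewrite divr_gt0.
apply: rp => //; [exact: normal_scale|by rewrite subrr normr0|].
rewrite subr0 normrZ ger0_norm ?divr_ge0 ?(ltW r0)//.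
have v1 : 0 < `|v| + 1 by rewrite ltr_wpDl.
by rewrite mulrAC ltr_pdivrMr// ltr_pM2l// ltrDl.
Qed.

Lemma subset_calE : M `<=` calE M.
Proof.
move=> xi Mxi; rewrite -[xi]addr0.
by apply: (prox_calE Mxi ltr01); rewrite scaler0; exact: prox0.
Qed.

Lemma metric_proj_id xi : M xi -> metric_proj M xi = xi.
Proof.
move=> Mxi; rewrite -[in LHS](addr0 xi).
by apply: (prox_metric_proj Mxi ltr01); rewrite scaler0; exact: prox0.
Qed.

Lemma calE_prox x : calE M x ->
  exists2 e, 0 < e & prox M (metric_proj M x) ((1 + e) *: (x - metric_proj M x)).
Proof.
move=> Ex; have [Mx|] := pselect (M x); last exact: calE_ray_extends.
exists 1; first exact: ltr01.
by rewrite metric_proj_id// subrr scaler0; exact: prox0.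
Qed.

(* The parameters [t] for which [xi] is closest to [xi + t v] form a closed
   interval, which [calE_prox] shows to be open in [0, 1]. *)
Lemma nu_starP xi v : nu_star M (xi, v) <->
  M xi /\ exists2 e, 0 < e & prox M xi ((1 + e) *: v).
Proof.
split=> [[[/= Mxi nv] seg]|[Mxi [e e0 pv]]]; last first.
  have e1 : 0 < 1 + e by rewrite addr_gt0.
  split; first split=> //=.
    have := normal_scale (1 + e)^-1 (prox_normal pv).
    by rewrite scalerA mulVf ?scale1r// gt_eqF.
  move=> _ [t /= t01 <-]; rewrite in_itv /= in t01.
  rewrite [_ - _]addrAC subrr add0r; apply: (prox_calE Mxi e0).
  by rewrite scalerA mulrC -scalerA; exact: prox_scale.
have inE t : 0 <= t <= 1 -> calE M (xi + t *: v).
  move=> t01; apply: seg; exists t; first by rewrite /= in_itv.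
  by rewrite [xi + v - xi]addrAC subrr add0r.
pose A := [set t | 0 <= t <= 1 /\ prox M xi (t *: v)].
have A0 : A 0 by split; [rewrite lexx ler01|rewrite scale0r; exact: prox0].
have ubA : has_ubound A by exists 1 => t [/andP[]].
pose s := sup A.
have s0 : 0 <= s by apply: ub_le_sup.
have s1 : s <= 1 by apply: ge_sup; [exists 0|move=> t [/andP[]]].
have ps : prox M xi (s *: v).
  move=> z Mz; rewrite dotZl.
  have [vz|vz] := leP (dot v (z - xi)) 0.
    apply: le_trans (dot_ge0 _); rewrite pmulr_rle0//.
    by rewrite mulr_ge0_le0.
  rewrite mulrCA -ler_pdivlMr ?mulr_gt0//.
  apply: ge_sup; first by exists 0.
  move=> t [_ /(_ z Mz)]; rewrite dotZl mulrCA.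
  by rewrite -ler_pdivlMr ?mulr_gt0.
have ext : exists2 e, 0 < e & prox M xi ((1 + e) *: (s *: v)).
  have [/eqP s_0|sv0] := eqVneq s 0.
    by exists 1 => //; rewrite (eqP s_0) scale0r scaler0; exact: prox0.
  have Es := inE s; rewrite s0 s1 in Es; have {}Es := Es isT.
  have us := interior_subset Es.
  have nxi : nearest M (xi + s *: v) xi.
    by apply/nearest_prox; rewrite addrAC subrr add0r.
  have := calE_prox Es; rewrite (metric_proj_eq us nxi).
  by rewrite [xi + _ - xi]addrAC subrr add0r.
have s_eq1 : s = 1.
  apply/eqP; rewrite eq_le s1 leNgt; apply/negP => slt1.
  (* At [s = 0], [ext] says nothing since [s *: v] vanishes; normality of [v] provides the first
     step instead. *)
  have [e e0 pe] : exists2 e, 0 < e & prox M xi ((s + e) *: v).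
    have [/eqP|sn0] := eqVneq s 0.
      move=> /eqP ->; have [e e0 pe] := normal_prox_small Mxi nv.
      by exists e => //; rewrite add0r.
    have [e e0 pe] := ext; exists (s * e); first by rewrite mulr_gt0// lt_def sn0.
    by rewrite -{1}(mulr1 s) -mulrDr mulrC -scalerA.
  pose t := Num.min 1 (s + e).
  have : A t.
    split; first by rewrite ge_min lexx /= le_min ler01 addr_ge0// ltW.
    have se0 : 0 < s + e by rewrite ltr_wpDl.
    have -> : t = t / (s + e) * (s + e) by rewrite divfK// gt_eqF.
    rewrite -scalerA; apply: prox_scale => //.
    rewrite divr_ge0 ?(ltW se0)//=; last by rewrite le_min ler01 ltW.
    by rewrite ler_pdivrMr// mul1r ge_min lexx orbT.
  move=> /(ub_le_sup ubA); rewrite -/s leNgt => /negP; apply.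
  by rewrite lt_min slt1 ltrDl.
by split=> //; move: ext; rewrite s_eq1 scale1r.
Qed.

Lemma Fstar_inv x : calE M x ->
  nu_star M (metric_proj M x, x - metric_proj M x) /\
  Fstar (metric_proj M x, x - metric_proj M x) = x.
Proof.
move=> Ex; split; last by rewrite /Fstar /= subrKC.
apply/nu_starP; split; last exact: calE_prox.
exact: (unpp_nearest (interior_subset Ex)).1.
Qed.

Lemma Fstar_calE (p : 'rV[R]_d * 'rV[R]_d) :
  nu_star M p -> calE M (Fstar p) /\ metric_proj M (Fstar p) = p.1.
Proof.
case: p => xi v /nu_starP[Mxi [e e0 pv]].
by split; [exact: prox_calE pv | exact: prox_metric_proj pv].
Qed.

End Stability.

(** * The reciprocal of the frontier function *)

(* Reciprocal of the frontier function, extended to be homogeneous in [v]. *)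
Definition kappa (R : realType) (d : nat) (M : set 'rV[R]_d) (xi v : 'rV[R]_d) : R :=
  inf [set t | 0 <= t /\
    forall z, M z -> 2 * dot v (z - xi) <= t * dot (z - xi) (z - xi)].

Section Kappa.
Context {R : realType} {d m : nat}.
Variable M : set 'rV[R]_d.
Hypothesis hM : is_submanifold 2 m M.
Implicit Types (u v w x y z xi h : 'rV[R]_d) (a b e t : R).

(** Finiteness rests on normality: [prox] at a short [e *: v] makes [e^-1] admissible. *)
Let kappa_has_inf xi v : nu M (xi, v) -> has_inf [set t | 0 <= t /\
    forall z, M z -> 2 * dot v (z - xi) <= t * dot (z - xi) (z - xi)].
Proof.
move=> [/= Mxi nv]; split; last by exists 0 => t [].
have [e e0 pe] := normal_prox_small hM Mxi nv.
exists e^-1; split=> [|z Mz]; first by rewrite invr_ge0 ltW.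
rewrite ler_pdivlMl//; apply: le_trans (pe z Mz).
by rewrite dotZl mulrCA.
Qed.

Lemma kappa_ge0 xi v : nu M (xi, v) -> 0 <= kappa M xi v.
Proof. by move=> /kappa_has_inf[ex _]; apply: lb_le_inf => // t []. Qed.

(** The infimum is attained: each [z] other than [xi] imposes a lower bound on [t], and [z = xi]
    imposes nothing. *)
Lemma kappa_leP xi v t : nu M (xi, v) -> 0 <= t -> kappa M xi v <= t <->
  forall z, M z -> 2 * dot v (z - xi) <= t * dot (z - xi) (z - xi).
Proof.
move=> nxv t0; have [ex lb] := kappa_has_inf nxv.
split=> [kt z Mz|h]; last exact: ge_inf.
have [/eqP|zxi] := eqVneq (z - xi) 0.
  by move=> /eqP ->; rewrite !dot0r !mulr0.
have q0 := dot_gt0 zxi.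
rewrite -ler_pdivrMr//; apply: le_trans kt; apply: lb_le_inf => // s [_ /(_ z Mz)].
by rewrite ler_pdivrMr.
Qed.

Lemma kappa_proxP xi v : nu M (xi, v) -> kappa M xi v <= 1 <-> prox M xi v.
Proof.
move=> /kappa_leP/(_ ler01) kP.
by split=> [/kP h z /h|h]; [rewrite mul1r|apply/kP => z /h; rewrite mul1r].
Qed.

Lemma nu_scale_in xi v t : nu M (xi, v) -> nu M (xi, t *: v).
Proof. by move=> [Mxi nv]; split=> //; exact: normal_scale. Qed.

Let kappaZ_le xi v t : nu M (xi, v) -> 0 <= t ->
  kappa M xi (t *: v) <= t * kappa M xi v.
Proof.
move=> nxv t0; have k0 := kappa_ge0 nxv.
apply/kappa_leP; [exact: nu_scale_in|exact: mulr_ge0|move=> z Mz].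
rewrite dotZl mulrCA -mulrA ler_wpM2l//.
by move: z Mz; apply/kappa_leP.
Qed.

Lemma kappaZ xi v t : nu M (xi, v) -> 0 <= t ->
  kappa M xi (t *: v) = t * kappa M xi v.
Proof.
move=> nxv t0; apply/eqP; rewrite eq_le kappaZ_le//=.
have [->|tn0] := eqVneq t 0.
  by rewrite mul0r; apply/kappa_ge0/nu_scale_in.
have tp : 0 < t by rewrite lt_def tn0.
rewrite -ler_pdivlMl// -{1}(scale1r v) -(mulVf tn0) -scalerA.
by apply: kappaZ_le; [exact: nu_scale_in|rewrite invr_ge0].
Qed.

Lemma kappa0 xi : nu M (xi, 0) -> kappa M xi 0 = 0.
Proof. by move=> n0; rewrite -(scale0r 0) kappaZ// mul0r. Qed.

Lemma nu_star_kappaP xi v : nu_star M (xi, v) <-> nu M (xi, v) /\ kappa M xi v < 1.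
Proof.
split=> [ns|[nxv k1]].
  have nxv := ns.1; split=> //.
  have [_ [e e0 pe]] := (nu_starP hM _ _).1 ns.
  have e1 : 0 < 1 + e by rewrite addr_gt0.
  have /(kappa_proxP (nu_scale_in _ nxv)) := pe.
  by rewrite kappaZ ?(ltW e1)// mulrC -ler_pdivlMr// mul1r => /le_lt_trans; apply;
    rewrite invf_lt1// ltrDl.
apply/(nu_starP hM); split; first exact: nxv.1.
have k0 := kappa_ge0 nxv.
(* With [k = kappa M xi v], [(1 + (1 - k)) * k = 1 - (1 - k)^2 <= 1]. *)
exists (1 - kappa M xi v); first by rewrite subr_gt0.
apply/kappa_proxP; first exact: nu_scale_in.
rewrite kappaZ//; last by lra.
by have := sqr_ge0 (1 - kappa M xi v); move: (kappa _ _ _) => k *; nra.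
Qed.

(** Points strictly inside the segment are [xi + v] with [kappa M xi v < 1] when
    [r * kappa M xi u <= 1]. Otherwise the segment passes strictly beyond the point where [kappa]
    equals [1], whose closed segment would lie in [calE M]. *)
Let segment_calEP xi u r : nu M (xi, u) -> 0 < r ->
  open_segment xi (xi + r *: u) `<=` calE M <-> r * kappa M xi u <= 1.
Proof.
move=> nxu r0; have k0 := kappa_ge0 nxu.
have E : xi + r *: u - xi = r *: u by rewrite addrAC subrr add0r.
split=> [seg|rk].
  rewrite leNgt; apply/negP => rk1.
  have rk0 : 0 < r * kappa M xi u by exact: lt_trans rk1.
  pose s := (r * kappa M xi u)^-1.
  have s0 : 0 < s by rewrite invr_gt0.
  have s1 : s < 1 by rewrite invf_lt1.
  have : nu_star M (xi, s *: (r *: u)).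
    split; first by do 2 apply: nu_scale_in.
    move=> _ [t + <-]; rewrite /= in_itv /= => /andP[t0 t1].
    rewrite [_ - xi]addrAC subrr add0r.
    have [->|tn0] := eqVneq t 0.
      by rewrite scale0r addr0; exact: (subset_calE hM nxu.1).
    apply: seg; exists (t * s); last by rewrite E -scalerA.
    have tp : 0 < t by rewrite lt_def tn0.
    rewrite /= in_itv /= mulr_gt0//=.
    by rewrite (le_lt_trans _ s1)// ler_piMl// ltW.
  move=> /nu_star_kappaP[_]; rewrite scalerA kappaZ ?mulr_ge0 ?ltW//.
  by rewrite -mulrA mulVf ?ltxx// gt_eqF.
move=> _ [t + <-]; rewrite /= in_itv /= => /andP[t0 t1]; rewrite E.
have : nu_star M (xi, t *: (r *: u)).
  apply/nu_star_kappaP; split; first by do 2 apply: nu_scale_in.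
  rewrite scalerA kappaZ ?mulr_ge0 ?ltW// -mulrA (le_lt_trans _ t1)//.
  by rewrite ler_piMr// ltW.
by move=> /(Fstar_calE hM)[].
Qed.

Lemma frontier_kappa0 xi u : nu M (xi, u) -> kappa M xi u = 0 ->
  frontier_fun M xi u = +oo%E.
Proof.
move=> nxu k0; apply/eqyP => r r0; apply: ereal_sup_ubound; exists r => //=.
by split=> //; apply/segment_calEP => //; rewrite k0 mulr0.
Qed.

Lemma frontier_kappa xi u : nu M (xi, u) -> 0 < kappa M xi u ->
  frontier_fun M xi u = ((kappa M xi u)^-1)%:E.
Proof.
move=> nxu k0; apply/eqP; rewrite eq_le; apply/andP; split.
  apply: ub_ereal_sup => _ [r [r0 seg] <-]; rewrite lee_fin -[leRHS]mul1r.
  by rewrite ler_pdivlMr//; apply/segment_calEP.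
apply: ereal_sup_ubound; exists (kappa M xi u)^-1 => //=.
split; first by rewrite invr_gt0.
by apply/segment_calEP; rewrite ?invr_gt0// mulVf// gt_eqF.
Qed.

Let kappa_unit xi v : nu M (xi, v) -> v != 0 ->
  kappa M xi v = enorm v * kappa M xi ((enorm v)^-1 *: v).
Proof.
move=> nxv v0; rewrite kappaZ// ?invr_ge0 ?enorm_ge0// mulrA mulfV ?mul1r//.
by rewrite gt_eqF// enorm_gt0.
Qed.

(** With [k] the value of [kappa] at the unit vector, the frontier function is [1 / k] and the
    quotient simplifies to [1 / (1 - enorm v * k)]. The default value [1] occurs for [v = 0] or
    [k = 0], where [kappa M xi v = 0]. *)
Lemma upper_thetaE xi v : nu_star M (xi, v) ->
  upper_theta M xi v = (1 - kappa M xi v)^-1.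
Proof.
move=> /nu_star_kappaP[nxv k1]; rewrite /upper_theta.
have [v0|v0] /= := eqVneq v 0.
  by move: nxv; rewrite v0 => nxv; rewrite kappa0// subr0 invr1.
have nxu := nu_scale_in (enorm v)^-1 nxv.
move: k1; rewrite (kappa_unit nxv v0).
have := kappa_ge0 nxu; rewrite le_eqVlt => /orP[/eqP k0|k0].
  by rewrite frontier_kappa0// -k0 mulr0 subr0 invr1.
rewrite frontier_kappa// ltry /=.
move: (kappa _ _ _) k0 => k k0; move: (enorm v) => n k1.
have kn0 : k != 0 by rewrite gt_eqF.
have nk0 : 1 - n * k != 0 by rewrite gt_eqF// subr_gt0.
by field; rewrite nk0 kn0.
Qed.

Lemma lower_thetaE xi v : nu M (xi, v) ->
  lower_theta M xi v = (1 + kappa M xi v)^-1.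
Proof.
move=> nxv; rewrite /lower_theta.
have [v0|v0] /= := eqVneq v 0.
  by move: nxv; rewrite v0 => nxv; rewrite kappa0// addr0 invr1.
have nxu := nu_scale_in (enorm v)^-1 nxv.
rewrite (kappa_unit nxv v0).
have := kappa_ge0 nxu; rewrite le_eqVlt => /orP[/eqP k0|k0].
  by rewrite frontier_kappa0// -k0 mulr0 addr0 invr1.
rewrite frontier_kappa// ltry /=.
have := enorm_ge0 v; move: (kappa _ _ _) k0 => k k0; move: (enorm v) => n n0.
have kn0 : k != 0 by rewrite gt_eqF.
have nk0 : 1 + n * k != 0 by rewrite gt_eqF// ltr_pwDl// mulr_ge0// ltW.
by field; rewrite nk0 kn0.
Qed.

Lemma cvg_kappa (T : Type) (F : set_system T) {FF : Filter F} (f g : T -> 'rV[R]_d) xi v :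
  f @ F --> xi -> g @ F --> v -> nu M (xi, v) ->
  (\forall x \near F, nu M (f x, g x)) ->
  kappa M (f x) (g x) @[x --> F] --> kappa M xi v.
Proof.
move=> fxi gv nxv nfg; have k0 := kappa_ge0 nxv.
have cz z : z - f x @[x --> F] --> z - xi by exact: cvgB (cvg_cst z) fxi.
have lower a : a < kappa M xi v -> \forall x \near F, a < kappa M (f x) (g x).
  move=> ak; have [a0|a0] := ltP a 0.
    by near=> x; rewrite (lt_le_trans a0)//; apply: kappa_ge0; near: x.
  have [z [Mz zlt]] : exists z, M z /\ a * dot (z - xi) (z - xi) < 2 * dot v (z - xi).
    apply: contrapT => /forallNP H; move: ak; rewrite ltNge => /negP; apply.
    apply/kappa_leP => // z Mz; rewrite leNgt; apply/negP => lt.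
    by apply: (H z).
  have nlt : \forall x \near F, a * dot (z - f x) (z - f x) < 2 * dot (g x) (z - f x).
    apply: near_lt zlt.
      exact: cvgM (cvg_cst a) (cvg_dot (cz z) (cz z)).
    exact: cvgM (cvg_cst (2 : R)) (cvg_dot gv (cz z)).
  near=> x; rewrite ltNge; apply/negP.
  have nx : nu M (f x, g x) by near: x.
  have lt : a * dot (z - f x) (z - f x) < 2 * dot (g x) (z - f x) by near: x.
  by move=> /(kappa_leP nx a0)/(_ z Mz); rewrite leNgt lt.
have upper a : kappa M xi v < a -> \forall x \near F, kappa M (f x) (g x) <= a.
  move=> ka; have a0 : 0 < a by exact: le_lt_trans ka.
  have aV0 : 0 <= a^-1 by rewrite invr_ge0 ltW.
  (* Scaling by [a^-1] brings [kappa] below [1]; stability then bounds it by [1] nearby, which is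
     the bound [a] before scaling. *)
  have : nu_star M (xi, a^-1 *: v).
    apply/nu_star_kappaP; split; first exact: nu_scale_in.
    by rewrite kappaZ// mulrC ltr_pdivrMr// mul1r.
  move=> /(nu_starP hM)[Mxi [e e0 pe]].
  have [r r0 [_ rP]] := prox_stable hM Mxi e0 pe.
  have nf : \forall x \near F, `|xi - f x| < r.
    by move/cvgrPdist_lt : fxi; apply.
  have cag : a^-1 *: g x @[x --> F] --> a^-1 *: v by exact: cvgZl_tmp.
  have ng : \forall x \near F, `|a^-1 *: v - a^-1 *: g x| < r.
    by move/cvgrPdist_lt : cag; apply.
  near=> x; have nx : nu M (f x, g x) by near: x.
  have : prox M (f x) (a^-1 *: g x).
    apply: rP; [exact: nx.1|exact: normal_scale nx.2| |].
      by rewrite distrC; near: x.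
    by rewrite distrC; near: x.
  move=> /(kappa_proxP (nu_scale_in _ nx)).
  by rewrite kappaZ// mulrC ler_pdivrMr// mul1r.
apply/cvgrPdist_le => e e0; near=> x.
have h1 : kappa M xi v - e < kappa M (f x) (g x).
  by near: x; apply: lower; rewrite ltrBlDr ltrDl.
have h2 : kappa M (f x) (g x) <= kappa M xi v + e.
  by near: x; apply: upper; rewrite ltrDl.
by rewrite ler_norml; apply/andP; split; lra.
Unshelve. all: by end_near. Qed.

End Kappa.

(** * The homeomorphisms *)

Lemma cvg_fst_within (T U : topologicalType) (A : set (T * U)) (x : T) (y : U) :
  p.1 @[p --> within A (nbhs (x, y))] --> x.
Proof. by apply: (@cvg_within_filter _ _ _ (nbhs (x, y))); exact: cvg_fst. Qed.

Lemma cvg_snd_within (T U : topologicalType) (A : set (T * U)) (x : T) (y : U) :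
  p.2 @[p --> within A (nbhs (x, y))] --> y.
Proof. by apply: (@cvg_within_filter _ _ _ (nbhs (x, y))); exact: cvg_snd. Qed.

Lemma cvg_snd_comp (S : Type) (F : set_system S) {FF : Filter F}
    (T U : topologicalType) (h : S -> T * U) (p : T * U) :
  h @ F --> p -> (h s).2 @[s --> F] --> p.2.
Proof. by case: p => x y hp; apply: (cvg_comp _ _ hp); exact: cvg_snd. Qed.

Section Homeomorphisms.
Context {R : realType} {d m : nat}.
Variable M : set 'rV[R]_d.
Hypothesis hM : is_submanifold 2 m M.
Implicit Types (u v w x y z xi h : 'rV[R]_d) (a b e t : R).

Lemma phiE xi v : nu_star M (xi, v) -> phi M (xi, v) = (xi, (1 - kappa M xi v)^-1 *: v).
Proof. by move=> ns; rewrite /phi /= (upper_thetaE hM ns). Qed.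

Lemma phi_invE xi w : nu M (xi, w) ->
  phi_inv M (xi, w) = (xi, (1 + kappa M xi w)^-1 *: w).
Proof. by move=> nw; rewrite /phi_inv /= (lower_thetaE hM nw). Qed.

Lemma phi_nu p : nu_star M p -> nu M (phi M p).
Proof.
case: p => xi v ns; rewrite phiE//; apply: nu_scale_in.
by have [] := (nu_star_kappaP hM _ _).1 ns.
Qed.

Lemma phi_inv_nu_star p : nu M p -> nu_star M (phi_inv M p).
Proof.
case: p => xi w nw; rewrite phi_invE//; have k0 := kappa_ge0 hM nw.
have k1 : 0 < 1 + kappa M xi w by rewrite ltr_pwDl.
apply/(nu_star_kappaP hM); split; first exact: nu_scale_in.
rewrite (kappaZ hM nw) ?invr_ge0 ?(ltW k1)// ltr_pdivrMl// mulr1.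
by rewrite ltrDr.
Qed.

(** With [k = kappa M xi v], homogeneity gives [kappa] the value [k / (1 - k)] at the image, and
    [1 + k / (1 - k) = 1 / (1 - k)] undoes the scaling. *)
Lemma phiK p : nu_star M p -> phi_inv M (phi M p) = p.
Proof.
case: p => xi v ns; have [nv k1] := (nu_star_kappaP hM _ _).1 ns.
have k1' : 0 < 1 - kappa M xi v by rewrite subr_gt0.
rewrite phiE// phi_invE; last exact: nu_scale_in.
rewrite (kappaZ hM nv) ?invr_ge0 ?(ltW k1')// scalerA -[in RHS](scale1r v).
congr (_, _ *: _); move: (kappa M xi v) k1' => k k1'.
field; rewrite gt_eqF//= ?gt_eqF//; lra.
Qed.

Lemma phi_invK p : nu M p -> phi M (phi_inv M p) = p.
Proof.
move=> np; have ns := phi_inv_nu_star np; move: np ns; case: p => xi w nw.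
rewrite phi_invE// => ns; rewrite phiE//.
have k0 := kappa_ge0 hM nw.
have k1 : 0 < 1 + kappa M xi w by rewrite ltr_pwDl.
rewrite (kappaZ hM nw) ?invr_ge0 ?(ltW k1)// scalerA -[in RHS](scale1r w).
congr (_, _ *: _); move: (kappa M xi w) k1 => k k1'.
by field; rewrite gt_eqF//= ?gt_eqF//; lra.
Qed.

Lemma cvg_phi (T : Type) (F : set_system T) {FF : Filter F} (f g : T -> 'rV[R]_d) xi v :
  f @ F --> xi -> g @ F --> v -> nu_star M (xi, v) ->
  (\forall x \near F, nu_star M (f x, g x)) ->
  phi M (f x, g x) @[x --> F] --> phi M (xi, v).
Proof.
move=> fxi gv ns nfg; have [nv k1] := (nu_star_kappaP hM _ _).1 ns.
rewrite phiE//.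
have c : (f x, (1 - kappa M (f x) (g x))^-1 *: g x) @[x --> F] -->
    (xi, (1 - kappa M xi v)^-1 *: v).
  have ck : kappa M (f x) (g x) @[x --> F] --> kappa M xi v.
    apply: (cvg_kappa hM fxi gv nv); near=> x.
    have : nu_star M (f x, g x) by near: x.
    by move=> /(nu_star_kappaP hM)[].
  have k0 : 1 - kappa M xi v != 0 by rewrite gt_eqF// subr_gt0.
  exact: (cvg_pair fxi (cvgZ (cvgV k0 (cvgB (cvg_cst (1 : R)) ck)) gv)).
apply: cvg_trans c; apply: near_eq_cvg; near=> x.
by rewrite phiE//; near: x.
Unshelve. all: by end_near. Qed.

Lemma cvg_phi_inv (T : Type) (F : set_system T) {FF : Filter F} (f g : T -> 'rV[R]_d) xi v :
  f @ F --> xi -> g @ F --> v -> nu M (xi, v) ->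
  (\forall x \near F, nu M (f x, g x)) ->
  phi_inv M (f x, g x) @[x --> F] --> phi_inv M (xi, v).
Proof.
move=> fxi gv nv nfg; have k0 := kappa_ge0 hM nv.
rewrite phi_invE//.
have c : (f x, (1 + kappa M (f x) (g x))^-1 *: g x) @[x --> F] -->
    (xi, (1 + kappa M xi v)^-1 *: v).
  have ck : kappa M (f x) (g x) @[x --> F] --> kappa M xi v.
    exact: (cvg_kappa hM fxi gv nv).
  have k1 : 1 + kappa M xi v != 0 by rewrite gt_eqF// ltr_pwDl.
  exact: (cvg_pair fxi (cvgZ (cvgV k1 (cvgD (cvg_cst (1 : R)) ck)) gv)).
apply: cvg_trans c; apply: near_eq_cvg; near=> x.
by rewrite phi_invE//; near: x.
Unshelve. all: by end_near. Qed.

Lemma phi_homeo : homeomorphism_between (nu_star M) (nu M) (phi M) (phi_inv M).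
Proof.
split.
- exact: phi_nu.
- exact: phi_inv_nu_star.
- by move=> p /set_mem; exact: phiK.
- by move=> p /set_mem; exact: phi_invK.
- apply/subspace_continuousP => -[xi v] ns.
  have c := @cvg_phi _ (within (nu_star M) (nbhs (xi, v))) _ fst snd xi v _ _ ns.
  have c1 : fst @ within (nu_star M) (nbhs (xi, v)) --> xi.
    exact: cvg_fst_within.
  have c2 : snd @ within (nu_star M) (nbhs (xi, v)) --> v.
    exact: cvg_snd_within.
  have -> : phi M = (fun p => phi M (p.1, p.2)) by apply/funext => -[].
  apply: c => //; near=> p; rewrite -surjective_pairing; near: p.
  exact: near_withinT.
- apply/subspace_continuousP => -[xi v] ns.
  have c := @cvg_phi_inv _ (within (nu M) (nbhs (xi, v))) _ fst snd xi v _ _ ns.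
  have c1 : fst @ within (nu M) (nbhs (xi, v)) --> xi.
    exact: cvg_fst_within.
  have c2 : snd @ within (nu M) (nbhs (xi, v)) --> v.
    exact: cvg_snd_within.
  have -> : phi_inv M = (fun p => phi_inv M (p.1, p.2)) by apply/funext => -[].
  apply: c => //; near=> p; rewrite -surjective_pairing; near: p.
  exact: near_withinT.
Unshelve. all: by end_near. Qed.

(** The metric projection recovers the base point from the sum. *)
Let Fstar_inj : {in nu_star M &, injective (@Fstar R d)}.
Proof.
move=> p q /set_mem/(Fstar_calE hM)[_ Ep] /set_mem/(Fstar_calE hM)[_ Eq] E.
have : p.1 = q.1 by rewrite -Ep -Eq E.
move: E; rewrite /Fstar; case: p {Ep} => a v; case: q {Eq} => a' v' /= + aa'.
by rewrite aa' => /addrI ->.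
Qed.

Lemma sigmaE x : calE M x -> sigma M x = phi M (metric_proj M x, x - metric_proj M x).
Proof.
move=> Ex; rewrite /sigma /=; have [ns {1}<-] := Fstar_inv hM Ex.
by rewrite pinvKV//; apply/mem_set.
Qed.

Lemma sigma_fst x : calE M x -> (sigma M x).1 = metric_proj M x.
Proof. by move=> Ex; rewrite sigmaE. Qed.

Lemma sigma_nu x : calE M x -> nu M (sigma M x).
Proof. by move=> Ex; rewrite sigmaE//; apply/phi_nu/(Fstar_inv hM Ex).1. Qed.

Lemma sigma_inv_calE p : nu M p -> calE M (sigma_inv M p).
Proof. by move=> /phi_inv_nu_star /(Fstar_calE hM)[]. Qed.

Lemma metric_proj_sigma_inv p : nu M p -> metric_proj M (sigma_inv M p) = p.1.
Proof. by move=> /phi_inv_nu_star /(Fstar_calE hM)[]. Qed.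

Lemma sigmaK x : calE M x -> sigma_inv M (sigma M x) = x.
Proof.
move=> Ex; have [ns E] := Fstar_inv hM Ex.
by rewrite sigmaE// /sigma_inv /= phiK.
Qed.

Lemma sigma_invK p : nu M p -> sigma M (sigma_inv M p) = p.
Proof.
move=> np; have ns := phi_inv_nu_star np.
by rewrite /sigma /sigma_inv /= pinvKV ?phi_invK//; apply/mem_set.
Qed.

Lemma sigma_within_continuous : {within calE M, continuous (sigma M)}.
Proof.
apply/subspace_continuousP => x Ex.
suff main : sigma M y @[y --> within (calE M) (nbhs x)] -->
    phi M (metric_proj M x, x - metric_proj M x).
  by rewrite -sigmaE in main.
have c1 : metric_proj M @ within (calE M) (nbhs x) --> metric_proj M x.
  by apply: (@cvg_within_filter _ _ _ (nbhs x)); exact: metric_proj_continuous.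
have c2 : y - metric_proj M y @[y --> within (calE M) (nbhs x)] --> x - metric_proj M x.
  exact: cvgB (@cvg_within _ (nbhs x) _ (calE M)) c1.
have nE : \forall y \near within (calE M) (nbhs x), calE M y by exact: near_withinT.
have c := cvg_phi c1 c2 (Fstar_inv hM Ex).1.
have {}c : phi M (metric_proj M y, y - metric_proj M y)
    @[y --> within (calE M) (nbhs x)] --> phi M (metric_proj M x, x - metric_proj M x).
  apply: c; near=> y.
  by have [|] := @Fstar_inv _ _ _ _ hM y _; first by near: y.
apply: cvg_trans c; apply: near_eq_cvg; near=> y.
by rewrite sigmaE//; near: y.
Unshelve. all: by end_near. Qed.

Lemma cvg_sigma_inv (T : Type) (F : set_system T) {FF : Filter F} (f g : T -> 'rV[R]_d) xi v :
  f @ F --> xi -> g @ F --> v -> nu M (xi, v) ->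
  (\forall x \near F, nu M (f x, g x)) ->
  sigma_inv M (f x, g x) @[x --> F] --> sigma_inv M (xi, v).
Proof.
move=> fxi gv nv nfg.
have c : phi_inv M (f x, g x) @[x --> F] --> phi_inv M (xi, v).
  exact: cvg_phi_inv.
have c2 : (phi_inv M (f x, g x)).2 @[x --> F] --> (phi_inv M (xi, v)).2.
  exact: cvg_snd_comp c.
exact: cvgD fxi c2.
Qed.

Lemma sigma_homeo : homeomorphism_between (calE M) (nu M) (sigma M) (sigma_inv M).
Proof.
split.
- exact: sigma_nu.
- exact: sigma_inv_calE.
- by move=> x /set_mem; exact: sigmaK.
- by move=> p /set_mem; exact: sigma_invK.
- exact: sigma_within_continuous.
- apply/subspace_continuousP => -[xi v] ns.
  have c1 : fst @ within (nu M) (nbhs (xi, v)) --> xi.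
    exact: cvg_fst_within.
  have c2 : snd @ within (nu M) (nbhs (xi, v)) --> v.
    exact: cvg_snd_within.
  have c := @cvg_sigma_inv _ (within (nu M) (nbhs (xi, v))) _ fst snd xi v c1 c2 ns.
  have -> : sigma_inv M = (fun p => sigma_inv M (p.1, p.2)) by apply/funext => -[].
  apply: c => //; near=> p; rewrite -surjective_pairing; near: p.
  exact: near_withinT.
Unshelve. all: by end_near. Qed.

Lemma sigma_fiber_bij xi : M xi ->
  set_bij (fiber (calE M) (metric_proj M) xi) (fiber (nu M) fst xi) (sigma M).
Proof.
move=> Mxi; split.
- by move=> x [Ex <-]; split; [exact: sigma_nu|exact: sigma_fst].
- move=> x y /set_mem[Ex _] /set_mem[Ey _] E.
  by rewrite -(sigmaK Ex) E sigmaK.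
- move=> p [np <-]; exists (sigma_inv M p); last exact: sigma_invK.
  by split; [exact: sigma_inv_calE|exact: metric_proj_sigma_inv].
Qed.

End Homeomorphisms.

(** * Normal spaces in a chart *)

Section NormalChart.
Context {R : realType} {d m : nat}.
Variables (M U V : set 'rV[R]_d) (Psi Phi : 'rV[R]_d -> 'rV[R]_d).
Hypotheses (oU : open U) (oV : open V) (PP : Ck_diffeomorphism 2 V U Psi Phi).
Hypothesis MPsi : forall y, V y -> (M (Psi y) <-> flat m y).
Implicit Types (u v w x y z a xi h : 'rV[R]_d) (e t : R).

Let dPhi x : U x -> differentiable Phi x.
Proof. exact: (diffeo_inv_Ck PP).1. Qed.

Let dPsi y : V y -> differentiable Psi y.
Proof. exact: (diffeo_Ck PP).1. Qed.

Lemma diff_PsiK x w : U x -> 'd Psi (Phi x) ('d Phi x w) = w.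
Proof.
move=> Ux; have [VPx _] := chart_inv PP Ux.
have dPP : differentiable (Psi \o Phi) x.
  by apply: differentiable_comp; [exact: dPhi|exact: dPsi].
have E : 'D_w (Psi \o Phi) x = 'd Psi (Phi x) ('d Phi x w).
  exact: etrans (deriveE w dPP) (congr1 (@^~ w) (diff_comp (dPhi Ux) (dPsi VPx))).
rewrite -E (@near_eq_derive _ _ _ _ id) ?derive_id//.
have nU : \forall y \near x, U y by exact: open_nbhs_nbhs.
by near=> y; have [|_ /=] := chart_inv PP (x := y); first by near: y.
Unshelve. all: by end_near. Qed.

Lemma diff_PhiK y w : V y -> 'd Phi (Psi y) ('d Psi y w) = w.
Proof.
move=> Vy; have UPy : U (Psi y) := diffeo_fun PP Vy.
have dPP : differentiable (Phi \o Psi) y.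
  by apply: differentiable_comp; [exact: dPsi|exact: dPhi].
have E : 'D_w (Phi \o Psi) y = 'd Phi (Psi y) ('d Psi y w).
  exact: etrans (deriveE w dPP) (congr1 (@^~ w) (diff_comp (dPsi Vy) (dPhi UPy))).
rewrite -E (@near_eq_derive _ _ _ _ id) ?derive_id//.
have nV : \forall z \near y, V z by exact: open_nbhs_nbhs.
near=> z; apply: (diffeo_K PP); apply/mem_set; near: z; exact: nV.
Unshelve. all: by end_near. Qed.

(** Read in the chart, a curve in [M] stays flat for times near [0], so the last coordinates of its
    velocity vanish. *)
Lemma tangent_flat xi u : U xi -> tangent_space M xi u -> flat m ('d Phi xi u).
Proof.
move=> Uxi [e [gam [e0 [dgam _] Mgam gam0 <-]]] i mi.
have e00 : `]- e, e[%classic (0 : R) by rewrite /= in_itv /= oppr_lt0 e0.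
have dg0 := dgam _ e00.
have dPg : differentiable Phi (gam 0) by rewrite gam0; exact: dPhi.
have dcomp : differentiable (Phi \o gam) 0 by exact: differentiable_comp.
have E : 'D_1 (Phi \o gam) 0 = 'd Phi xi (derive1 gam 0).
  rewrite (derive1E' dg0) -gam0.
  exact: etrans (deriveE (1 : R) dcomp) (congr1 (@^~ (1 : R)) (diff_comp dg0 dPg)).
have der : is_derive (0 : R) 1 (Phi \o gam) ('d Phi xi (derive1 gam 0)).
  by split => //; exact: diff_derivable.
have [_ <-] := is_derive_coord i der.
rewrite (@near_eq_derive _ _ _ _ (cst 0)) ?derive_cst//.
have nU : \forall t \near (0 : R), U (gam t).
  have nU0 : nbhs (gam 0) U by rewrite gam0; exact: open_nbhs_nbhs.
  exact: (differentiable_continuous dg0 nU0).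
have ne : \forall t \near (0 : R), `]- e, e[%classic t.
  by apply: open_nbhs_nbhs; split=> //; exact: interval_open.
near=> t; have Ut : U (gam t) by near: t.
have Mt : M (gam t) by apply: Mgam; near: t.
by rewrite /= (chart_flat PP MPsi Ut Mt).
Unshelve. all: by end_near. Qed.

(** The first [m] columns of ['d Psi] span the tangent space: [tangent_chart] shows that they are
    tangent, [tangent_flat] that nothing else is needed. *)
Lemma normal_chartP xi v : U xi -> M xi -> Defs.normal_space M xi v <->
  forall i : 'I_d, (i < m)%N -> dot v ('d Psi (Phi xi) (ebasis i)) = 0.
Proof.
move=> Uxi Mxi; have [VPx PPx] := chart_inv PP Uxi.
split=> [nv i im|h u tu].
  apply: nv; rewrite -[in tangent_space _ _]PPx.
  apply: (tangent_chart oV PP MPsi VPx (chart_flat PP MPsi Uxi Mxi)) => j mj.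
  rewrite mxE /= (_ : (j == i) = false)//.
  by apply/negP => /eqP ji; move: mj; rewrite ji leqNgt im.
have fu := tangent_flat Uxi tu.
have <- : 'd Psi (Phi xi) ('d Phi xi u) = u by exact: diff_PsiK.
have -> := diff_ebasis Psi (Phi xi) ('d Phi xi u).
rewrite dot_lincombr big1// => i _.
have [im|mi] := ltnP i m; first by rewrite h// mulr0.
by rewrite fu// mul0r.
Qed.

End NormalChart.

(** * The vector bundle *)

Lemma big_ord_split (V : nmodType) (p q n : nat) (e : (p + q)%N = n) (F : 'I_n -> V) :
  \sum_(i < n) F i = \sum_(j < p) F (cast_ord e (lshift q j)) +
                     \sum_(k < q) F (cast_ord e (rshift p k)).
Proof.
case: n / e F => F; rewrite big_split_ord.
by congr (_ + _); apply: eq_bigr => i _; rewrite cast_ord_id.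
Qed.

Lemma cvg_eq (S : Type) (T : topologicalType) (F : set_system S) (f g : S -> T) (l l' : T) :
  (forall x, f x = g x) -> l = l' -> g @ F --> l' -> f @ F --> l.
Proof. by move=> /funext -> ->. Qed.

(** * A continuous frame of the normal bundle over a chart domain *)

Section NormalFrame.
Context {R : realType} {d m : nat}.
Hypothesis hmd : (m < d)%N.
Variables (M U V : set 'rV[R]_d) (Psi Phi : 'rV[R]_d -> 'rV[R]_d).
Hypotheses (oU : open U) (oV : open V) (PP : Ck_diffeomorphism 2 V U Psi Phi).
Hypothesis MPsi : forall y, V y -> (M (Psi y) <-> flat m y).
Implicit Types (u v w x y z a xi h : 'rV[R]_d) (e t : R) (c : 'rV[R]_(d - m)).

Definition last_index (k : 'I_(d - m)) : 'I_d :=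
  cast_ord (subnKC (ltnW hmd)) (rshift m k).

(** Pairing with the columns of ['d Psi] transversal to [M]; on the normal space these are the
    coordinates with respect to [normal_frame]. *)
Definition normal_coord xi v : 'rV[R]_(d - m) :=
  \row_k dot v ('d Psi (Phi xi) (ebasis (last_index k))).

Let normal_coordE xi v k :
  normal_coord xi v ord0 k = dot v ('d Psi (Phi xi) (ebasis (last_index k))).
Proof. by rewrite mxE. Qed.

(* The last [d - m] components of [Phi] have gradients spanning the normal space. *)
Definition normal_frame xi c : 'rV[R]_d :=
  \row_l \sum_k c ord0 k * 'd Phi xi (ebasis l) ord0 (last_index k).

Let normal_frameE xi c l : normal_frame xi c ord0 l =
  \sum_k c ord0 k * 'd Phi xi (ebasis l) ord0 (last_index k).
Proof. by rewrite mxE. Qed.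

(** The frame is the transpose of the last components of ['d Phi xi], so its pairings with columns
    of ['d Psi] follow from ['d Phi] and ['d Psi] being inverse. *)
Lemma dot_normal_frame xi c w :
  dot (normal_frame xi c) w = \sum_k c ord0 k * 'd Phi xi w ord0 (last_index k).
Proof.
have -> : 'd Phi xi w = \sum_l w ord0 l *: 'd Phi xi (ebasis l) by exact: diff_ebasis.
rewrite /dot /normal_frame; under eq_bigr do rewrite mxE mulr_suml.
rewrite exchange_big; apply: eq_bigr => k _; rewrite summxE mulr_sumr.
by apply: eq_bigr => l _; rewrite mxE -mulrA [X in _ * X]mulrC.
Qed.

Lemma diff_Phi_chart xi w : U xi -> 'd Phi xi ('d Psi (Phi xi) w) = w.
Proof.
move=> Uxi; have [VPx PPx] := chart_inv PP Uxi.
by have := diff_PhiK oV PP w VPx; rewrite PPx.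
Qed.

Lemma normal_frame_normal xi c : U xi -> M xi -> Defs.normal_space M xi (normal_frame xi c).
Proof.
move=> Uxi Mxi; apply/(normal_chartP oU oV PP MPsi) => // i im.
rewrite dot_normal_frame big1// => k _; rewrite (diff_Phi_chart _ Uxi) mxE /=.
rewrite (_ : (last_index k == i) = false) ?mulr0//.
by apply/negP => /eqP ki; move: im; rewrite -ki /= ltnNge leq_addr.
Qed.

Lemma normal_frameK xi c : U xi -> normal_coord xi (normal_frame xi c) = c.
Proof.
move=> Uxi; apply/rowP => k; rewrite mxE dot_normal_frame (bigD1 k)//=.
rewrite (diff_Phi_chart _ Uxi) mxE !eqxx mulr1 big1 ?addr0// => j jk.
rewrite mxE /= (_ : (last_index j == last_index k) = false) ?mulr0//.
apply/negP => /eqP /(congr1 val) /= /addnI jk'.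
by move: jk; rewrite (val_inj jk') eqxx.
Qed.

(** Each [ebasis l] is expanded as ['d Psi] applied to ['d Phi xi (ebasis l)]; pairing with the
    normal vector [v] kills the first [m] columns. *)
Lemma normal_coordK xi v : U xi -> M xi -> Defs.normal_space M xi v ->
  normal_frame xi (normal_coord xi v) = v.
Proof.
move=> Uxi Mxi /(normal_chartP oU oV PP MPsi _ Uxi Mxi) nv; apply/rowP => l.
rewrite mxE.
have -> : v ord0 l = dot v (ebasis l).
  rewrite /dot (bigD1 l)//= mxE !eqxx mulr1 big1 ?addr0// => j jl.
  by rewrite mxE (negbTE jl) mulr0.
have E : 'd Psi (Phi xi) ('d Phi xi (ebasis l)) = ebasis l.
  exact: (diff_PsiK oU PP _ Uxi).
have -> : dot v (ebasis l) = \sum_i 'd Phi xi (ebasis l) ord0 i *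
    dot v ('d Psi (Phi xi) (ebasis i)).
  rewrite -dot_lincombr; congr (dot v _).
  exact: etrans (esym E) (diff_ebasis _ _ _).
rewrite (big_ord_split (subnKC (ltnW hmd))) [X in _ = X + _]big1 ?add0r; last first.
  by move=> j _; rewrite nv ?mulr0//=.
by apply: eq_bigr => k _; rewrite mxE mulrC.
Qed.

Lemma normal_coordD xi v w : normal_coord xi (v + w) = normal_coord xi v + normal_coord xi w.
Proof. by apply/rowP => k; rewrite !mxE dotDl. Qed.

Lemma normal_coordZ xi t v : normal_coord xi (t *: v) = t *: normal_coord xi v.
Proof. by apply/rowP => k; rewrite !mxE dotZl. Qed.

Lemma cvg_normal_coord (T : Type) (F : set_system T) {FF : Filter F}
    (f g : T -> 'rV[R]_d) xi v : U xi -> f @ F --> xi -> g @ F --> v ->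
  normal_coord (f x) (g x) @[x --> F] --> normal_coord xi v.
Proof.
move=> Uxi fxi gv; have [VPx _] := chart_inv PP Uxi.
have cP : Phi (f x) @[x --> F] --> Phi xi := cvg_comp _ _ fxi (Phi_continuous PP Uxi).
have ck k : dot (g x) ('d Psi (Phi (f x)) (ebasis (last_index k))) @[x --> F] -->
    dot v ('d Psi (Phi xi) (ebasis (last_index k))).
  have cD : {for Phi xi, continuous (fun y => 'd Psi y (ebasis (last_index k)))}.
    by apply: differentiable_continuous; exact: ((diffeo_Ck PP).2 _).1.
  exact: (cvg_dot gv (cvg_comp _ _ cP cD)).
apply: cvg_rV => k.
exact: (cvg_eq (fun s => normal_coordE (f s) (g s) k) (normal_coordE xi v k) (ck k)).
Qed.

Lemma cvg_normal_frame (T : Type) (F : set_system T) {FF : Filter F}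
    (f : T -> 'rV[R]_d) (g : T -> 'rV[R]_(d - m)) xi c :
  U xi -> f @ F --> xi -> g @ F --> c ->
  normal_frame (f x) (g x) @[x --> F] --> normal_frame xi c.
Proof.
move=> Uxi fxi gc.
have cl l : \sum_k g x ord0 k * 'd Phi (f x) (ebasis l) ord0 (last_index k) @[x --> F] -->
    \sum_k c ord0 k * 'd Phi xi (ebasis l) ord0 (last_index k).
  have cD : {for xi, continuous (fun y => 'd Phi y (ebasis l))}.
    by apply: differentiable_continuous; exact: ((diffeo_inv_Ck PP).2 _).1.
  apply: cvg_bigsum => k.
  exact: (cvgM (cvg_coord gc) (cvg_coord (cvg_comp _ _ fxi cD))).
apply: cvg_rV => l.
exact: (cvg_eq (fun s => normal_frameE (f s) (g s) l) (normal_frameE xi c l) (cl l)).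
Qed.

End NormalFrame.

Lemma is_vector_space_transport (R : realType) (d : nat) (Y : Type) (F : set Y)
    (N : set 'rV[R]_d) (L : Y -> 'rV[R]_d) (S : 'rV[R]_d -> Y) :
  N 0 -> (forall v w, N v -> N w -> N (v + w)) ->
  (forall (t : R) v, N v -> N (t *: v)) ->
  (forall x, F x -> N (L x)) -> (forall v, N v -> F (S v)) ->
  (forall x, F x -> S (L x) = x) -> (forall v, N v -> L (S v) = v) ->
  is_vector_space F (fun x y => S (L x + L y)) (fun (t : R) x => S (t *: L x)).
Proof.
move=> N0 ND NZ FL NS SK LK; split.
- by move=> x y Fx Fy; apply/NS/ND; exact: FL.
- by move=> t x Fx; apply/NS/NZ/FL.
- move=> x y z Fx Fy Fz; rewrite !LK ?addrA//; apply: ND; exact: FL.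
- by move=> x y _ _; rewrite addrC.
- exists (S 0); split=> [|x Fx|x Fx]; first exact: NS.
    by rewrite LK// add0r SK.
  exists (S (- L x)); first by rewrite -scaleN1r; apply/NS/NZ/FL.
  by rewrite LK ?subrr// -scaleN1r; apply/NZ/FL.
- by move=> s t x Fx; rewrite LK ?scalerA//; apply/NZ/FL.
- by move=> x Fx; rewrite scale1r SK.
- move=> t x y Fx Fy; rewrite !LK ?scalerDr//; do ?apply: ND; do ?apply: NZ; exact: FL.
- move=> s t x Fx; rewrite !LK ?scalerDl//; apply: NZ; exact: FL.
Qed.

Lemma calE_vector_bundle (R : realType) (d m : nat) (M : set 'rV[R]_d) :
  (m < d)%N -> is_submanifold 2 m M ->
  is_vector_bundle (d - m) M (calE M) (metric_proj M) (calE_add M) (calE_scale M).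
Proof.
move=> hmd hM.
have fib xi x : fiber (calE M) (metric_proj M) xi x ->
    sigma M x = (xi, (sigma M x).2) /\ nu M (xi, (sigma M x).2).
  move=> [Ex <-]; rewrite -(sigma_fst hM Ex) -surjective_pairing.
  by split=> //; exact: (sigma_nu hM Ex).
have fibS xi v : nu M (xi, v) -> fiber (calE M) (metric_proj M) xi (sigma_inv M (xi, v)).
  by move=> nv; split; [exact: (sigma_inv_calE hM nv)|rewrite (metric_proj_sigma_inv hM nv)].
have projM x : calE M x -> M (metric_proj M x).
  by move=> Ex; exact: (unpp_nearest (interior_subset Ex)).1.
split.
- apply/seteqP; split=> [_ [x Ex <-]|xi Mxi]; first exact: projM.
  by exists xi; [exact: (subset_calE hM)|exact: (metric_proj_id hM)].
- apply: continuous_in_subspaceT => x /set_mem; exact: metric_proj_continuous.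
(* [calE_add] and [calE_scale] unfold to the operations transported along these two maps. *)
- move=> xi Mxi; apply: (@is_vector_space_transport _ _ _ _ (Defs.normal_space M xi)
    (fun x => (sigma M x).2) (fun v => sigma_inv M (xi, v))).
  + exact: normal0.
  + exact: normalD.
  + by move=> t v; exact: normal_scale.
  + by move=> x /fib[_ []].
  + by move=> v nv; exact: fibS.
  + by move=> x Fx; have [<- _] := fib _ _ Fx; apply: (sigmaK hM); exact: Fx.1.
  + by move=> v nv; rewrite (sigma_invK hM).
- move=> b Mb; have [U [V [Psi [Phi [oU oV Ub PP MPsi]]]]] := hM.2 _ Mb.
  (* The trivialisation is [sigma] followed by linear coordinates on each normal space, so it is
     linear on fibres for the transported operations. *)
  pose h x := (metric_proj M x, normal_coord hmd Psi Phi (metric_proj M x) (sigma M x).2).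
  pose g (p : 'rV[R]_d * 'rV[R]_(d - m)) := sigma_inv M (p.1, normal_frame hmd Phi p.1 p.2).
  have nu_frame xi c : U xi -> M xi -> nu M (xi, normal_frame hmd Phi xi c).
    by move=> Uxi Mxi; split=> //; exact: (normal_frame_normal hmd oU oV PP MPsi).
  have sigma_pair x : calE M x -> sigma M x = (metric_proj M x, (sigma M x).2).
    by move=> Ex; rewrite -(sigma_fst hM Ex) -surjective_pairing.
  exists U, h, g; split=> //.
  + split.
    * by move=> x [Ex Ux]; split=> //; split=> //; exact: projM.
    * move=> [xi c] [[/= Mxi Uxi] _]; have nf := nu_frame xi c Uxi Mxi.
      by split; [exact: (sigma_inv_calE hM nf)|rewrite /= /g (metric_proj_sigma_inv hM nf)].
    * move=> x /set_mem[Ex Ux]; rewrite /g /h /= (normal_coordK hmd oU oV PP MPsi Ux).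
      - by rewrite -sigma_pair// (sigmaK hM).
      - exact: projM.
      - by have := sigma_nu hM Ex; rewrite sigma_pair// => -[].
    * move=> [xi c] /set_mem[[/= Mxi Uxi] _]; have nf := nu_frame xi c Uxi Mxi.
      have -> : g (xi, c) = sigma_inv M (xi, normal_frame hmd Phi xi c) by [].
      by rewrite /h (metric_proj_sigma_inv hM nf) (sigma_invK hM nf)
        (normal_frameK hmd oV PP).
    * apply/subspace_continuousP => x [Ex Ux].
      set D := calE M `&` _.
      have c1 : metric_proj M y @[y --> within D (nbhs x)] --> metric_proj M x.
        by apply: (@cvg_within_filter _ _ _ (nbhs x)); exact: metric_proj_continuous.
      have c2 : sigma M y @[y --> within D (nbhs x)] --> sigma M x.
        have cE := (subspace_continuousP _ _).1 (sigma_within_continuous hM) x Ex.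
        by apply: cvg_trans cE; apply: cvg_fmap2; apply: within_subset; exact: subIsetl.
      have c3 : (sigma M y).2 @[y --> within D (nbhs x)] --> (sigma M x).2.
        exact: cvg_snd_comp c2.
      exact: (cvg_pair c1 (cvg_normal_coord PP Ux c1 c3)).
    * apply/subspace_continuousP => -[xi c] [[/= Mxi Uxi] _].
      set D := _ `*` setT.
      have nD : \forall p \near within D (nbhs (xi, c)), D p by exact: near_withinT.
      have c1 : p.1 @[p --> within D (nbhs (xi, c))] --> xi by exact: cvg_fst_within.
      have c2 : p.2 @[p --> within D (nbhs (xi, c))] --> c by exact: cvg_snd_within.
      apply: (cvg_sigma_inv hM c1 (cvg_normal_frame PP Uxi c1 c2)).
        exact: nu_frame.
      near=> p; have [[Mp Up] _] : D p by near: p.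
      exact: nu_frame.
  + move=> c [Mc Uc]; split=> [x y Fx Fy|t x Fx].
    * have [_ nx] := fib _ _ Fx; have [_ ny] := fib _ _ Fy.
      have nxy : nu M (c, (sigma M x).2 + (sigma M y).2).
        by split=> //; apply: normalD; [exact: nx.2|exact: ny.2].
      rewrite /h (metric_proj_sigma_inv hM nxy) (sigma_invK hM nxy).
      by rewrite Fx.2 Fy.2 -normal_coordD.
    * have [_ nx] := fib _ _ Fx.
      have ntx : nu M (c, t *: (sigma M x).2) by exact: nu_scale_in.
      rewrite /h (metric_proj_sigma_inv hM ntx) (sigma_invK hM ntx).
      by rewrite Fx.2 -normal_coordZ.
Unshelve. all: by end_near. Qed.

Theorem corollary2 (R : realType) (d m : nat) (M : set 'rV[R]_d)
    (hm : (1 <= m)%N) (hmd : (m < d)%N) (hM : is_submanifold 2 m M) :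
  [/\ homeomorphism_between (nu_star M) (nu M) (phi M) (phi_inv M),
      homeomorphism_between (calE M) (nu M) (sigma M) (sigma_inv M),
      forall xi, M xi ->
        set_bij (fiber (calE M) (metric_proj M) xi) (fiber (nu M) fst xi)
          (sigma M) &
      is_vector_bundle (d - m) M (calE M) (metric_proj M)
        (calE_add M) (calE_scale M)].
Proof.
split.
- exact: phi_homeo hM.
- exact: sigma_homeo hM.
- exact: sigma_fiber_bij hM.
- exact: calE_vector_bundle.
Qed.
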